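(* Let $\overline{r}=0.466\dots$ denote the unique $r\in(0,1)$ satisfying $\tfrac32 r\log r-r+1=0$, and let $\underline{r}=0.209\dots$ denote the maximum value of $r<1$ such that the function $f_r$ (defined in the context) has a zero in the open interval $(0,r)$. If $\overline{r}<r\le1$, then the constant graphon $W\equiv r$ uniquely minimizes $\mathsf{LT}(K_3,r)$. If $0\le r<\underline{r}$, then the constant graphon $W\equiv r$ does not minimize $\mathsf{LT}(K_3,r)$.
   Context: A graphon is a symmetric measurable function $W\colon[0,1]^2\to[0,1]$. $K_3$ is the triangle, and $t(K_3,W):=\int_{[0,1]^3}W(x,y)W(x,z)W(y,z)\,dx\,dy\,dz$. For a function $f$, write $\mathbb{E}[f(W)]:=\int_{[0,1]^2}f(W(x,y))\,dx\,dy$. Let $h(x):=x\log x-x+1$ for $x\in[0,1]$ (with $h(0)=1$). For $0\le r\le1$, $\mathsf{LT}(K_3,r)$ denotes the variational problem (and also its value): minimize $\mathbb{E}[h(W)]$ over all graphons $W$ subject to $t(K_3,W)\le r^3$. Graphons are identified if they differ on a set of measure zero or by a measure-preserving transformation of $[0,1]$; uniqueness of minimizers is understood up to this identification. For $0<r<1$, define $f_r(x):=\tfrac12h(x)+\tfrac12h\Big(\sqrt{\tfrac{4r^3-x^3}{3x}}\Big)-h(r)$ for those $x\in(0,r]$ with $\sqrt{(4r^3-x^3)/(3x)}\le1$. *)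

(* Defs.v *)
From Stdlib Require Export Relation_Operators.
From mathcomp Require Export all_boot all_order all_algebra.
From mathcomp Require Export all_classical all_reals all_analysis.

Set Implicit Arguments.
Unset Strict Implicit.
Unset Printing Implicit Defensive.

Import Order.TTheory GRing.Theory Num.Theory.
Import numFieldNormedType.Exports.

Local Open Scope classical_set_scope.
Local Open Scope ring_scope.
Local Open Scope ereal_scope.

Section graphons.
Context {R : realType}.
Local Notation leb := (@lebesgue_measure R).

Definition I01 : set R := `[0%R, 1%R].

(* A graphon is represented by a total function on R * R of which only the
   values on the unit square matter.  Measurability is with respect to the
   Borel sigma-algebra; up to null sets this is the same as Lebesgue
   measurability. *)
Definition graphon (W : R * R -> R) : Prop :=
  [/\ measurable_fun (I01 `*` I01) W,
      forall x y, I01 x -> I01 y -> W (x, y) = W (y, x)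
    & forall x y, I01 x -> I01 y -> (0 <= W (x, y) <= 1)%R].

Definition triangle_density (W : R * R -> R) : \bar R :=
  \int[(leb \x leb) \x leb]_(p in (I01 `*` I01) `*` I01)
    (let: ((x, y), z) := p in (W (x, y) * W (x, z) * W (y, z))%R)%:E.

Definition graphon_expectation (f : R -> R) (W : R * R -> R) : \bar R :=
  \int[leb \x leb]_(p in I01 `*` I01) (f (W p))%:E.

(* [ln 0 = 0] in the library, so [h 0 = 1]. *)
Definition h (x : R) : R := (x * ln x - x + 1)%R.

Definition measure_preserving (phi : R -> R) : Prop :=
  [/\ measurable_fun I01 phi,
      forall x, I01 x -> I01 (phi x)
    & forall A : set R, measurable A -> A `<=` I01 ->
        leb (I01 `&` phi @^-1` A) = leb A].

Definition graphon_ae_eq (W W' : R * R -> R) : Prop :=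
  {ae leb \x leb, forall p, (I01 `*` I01) p -> W p = W' p}.

Definition graphon_rearrangement (W W' : R * R -> R) : Prop :=
  exists2 phi : R -> R, measure_preserving phi &
    forall x y, I01 x -> I01 y -> W' (x, y) = W (phi x, phi y).

(* The identification of graphons: the equivalence relation generated by almost
   everywhere equality and by measure-preserving transformations. *)
Definition graphon_equiv : (R * R -> R) -> (R * R -> R) -> Prop :=
  @clos_refl_sym_trans (R * R -> R) (fun W W' =>
    [/\ graphon W, graphon W' &
        graphon_ae_eq W W' \/ graphon_rearrangement W W']).

Definition LT_K3_feasible (r : R) (W : R * R -> R) : Prop :=
  graphon W /\ triangle_density W <= (r ^+ 3)%:E.

Definition minimizes_LT_K3 (r : R) (W : R * R -> R) : Prop :=
  LT_K3_feasible r W /\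
  forall W', LT_K3_feasible r W' ->
    graphon_expectation h W <= graphon_expectation h W'.

Definition uniquely_minimizes_LT_K3 (r : R) (W : R * R -> R) : Prop :=
  minimizes_LT_K3 r W /\
  forall W', minimizes_LT_K3 r W' -> graphon_equiv W' W.

Definition f_arg (r x : R) : R :=
  Num.sqrt ((4 * r ^+ 3 - x ^+ 3) / (3 * x))%R.

(* Meaningful for [0 < x <= r] with [f_arg r x <= 1]. *)
Definition f_r (r x : R) : R := (h x / 2 + h (f_arg r x) / 2 - h r)%R.

Definition f_has_zero (r : R) : Prop :=
  exists x : R, [/\ (0 < x < r)%R, (f_arg r x <= 1)%R & f_r r x = 0%R].

Definition is_rbar (r : R) : Prop :=
  (0 < r < 1)%R /\ (3 / 2 * r * ln r - r + 1 = 0)%R.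

Definition is_runder (r : R) : Prop :=
  let S := [set s : R | (0 < s < 1)%R /\ f_has_zero s] in S r /\ ubound S r.

End graphons.

(* Main.v *)
Require Import Defs.
From HB Require Import structures.
From mathcomp Require Import ring lra measurable_realfun.
Import Order.TTheory GRing.Theory Num.Theory numFieldNormedType.Exports.
Set Implicit Arguments.
Unset Strict Implicit.
Unset Printing Implicit Defensive.
Local Open Scope classical_set_scope.
Local Open Scope ring_scope.


(** Large r.  Write W = r + u, and let d and q be the means of u and of u ^ 2.
    Expanding the triangle density of W gives
      r ^ 3 + 3 r ^ 2 d + r (mean of u u over the three cherries) + t(K_3, u).
    A cherry mean is the mean of a squared degree, so it is nonnegative, and
    since |u| <= K with K = max(r, 1 - r), the last term is at least - K q
    ([triangle_mean_ge]).  Hence t(K_3, W) <= r ^ 3 forces 3 r ^ 2 d <= K q: the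
    mean of W can exceed r only at the price of a proportional variance.  On the
    other side h lies above a parabola tangent at r with second order
    coefficient 3 / (4 r + 2) ([h_ge_quadratic]), so that
      E h(W) - h(r) >= d ln r + 3 q / (4 r + 2).
    When r >= 0.466 the price paid in q outweighs what d can earn
    ([slope_dominated]), and equality forces q = 0, that is W = r almost
    everywhere.  The defining equation of rbar says that h meets the chord
    x |-> (1 - x) / 3 at rbar; it does so at 1 as well, and strict convexity
    leaves no third point.

    Small r.  The graphon equal to x on the two diagonal blocks of halves and to
    y off them has triangle density (x ^ 3 + 3 x y ^ 2) / 4, and f_r measures its
    excess cost when this density is r ^ 3.  Put x = s u and y = s v.  The
    constraint becomes u ^ 3 + 3 u v ^ 2 = 4, in which s no longer occurs, and
    since h(s t) = s h(t) + s (t - 1) ln s + h(s),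
      f_s(s u) = (s / 2) (h(u) + h(v) + (u + v - 2) ln s)
    with u + v > 2.  So f_s(s u) vanishes for exactly one s,
    [zero_scale u] = exp (- (h(u) + h(v)) / (u + v - 2)), and is negative for
    every smaller s: shrinking the block graphon that ties with the constant at
    runder makes it win.  Finally runder is the maximum of [zero_scale] over the
    u for which s v <= 1; numerical estimates confine the maximizer to a compact
    interval, on which this side condition is automatic ([is_runder_exists]). *)

(** * Logarithm and entropy estimates *)

(** A rational approximation of ln at 1, exact up to order 3 there; it is chosen
    so that multiplying by y gives Bernstein's lower bound of h. *)
Definition ln_pade {R : realType} (y : R) : R := (y - 1) * (5 * y + 1) / (2 * y * (y + 2)).

(** The derivative of the difference is (t - 1) ^ 3 / (t ^ 2 (t + 2) ^ 2), so the
    difference decreases up to 1, where it vanishes, and increases afterwards. *)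
Lemma ln_pade_le (R : realType) (y : R) : 0 < y -> ln_pade y <= ln y.
Proof.
move=> y0.
(* partial fractions of ln t - ln_pade t, which are easy to differentiate *)
pose F (t : R) := ln t + 4^-1 *: t^-1 + (27 / 4) *: (t + 2)^-1 - 5 / 2.
pose F' (t : R) := (t - 1) ^+ 3 / (t ^+ 2 * (t + 2) ^+ 2).
have FE (t : R) : 0 < t -> F t = ln t - ln_pade t.
  by move=> t0; rewrite /F /ln_pade /GRing.scale/=; field; lra.
have dF (t : R) : 0 < t -> is_derive t 1 F (F' t).
  move=> t0.
  have t0' : t != 0 by lra.
  have t2' : t + 2 != 0 by lra.
  have d1 := is_derive1_ln t0.
  have d2 := is_deriveV t0' (is_derive_id t (1 : R)).
  have d3 := is_deriveD (is_derive_id t (1 : R)) (is_derive_cst (2 : R) t (1 : R)).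
  have d4 := is_deriveV (f := id + cst 2) t2' d3.
  have d5 := is_deriveD (is_deriveD d1 (is_deriveZ (4^-1 : R) d2)) (is_deriveZ (27 / 4 : R) d4).
  have d6 := is_deriveB d5 (is_derive_cst (5 / 2 : R) t (1 : R)).
  apply: (is_derive_eq (f := F) d6).
  by rewrite /F' /GRing.scale/= /cst /= !addrfctE /=; field; lra.
have cF (a b : R) : 0 < a -> {within `[a, b], continuous F}.
  move=> a0; apply: derivable_within_continuous => x; rewrite in_itv/= => /andP[ax _].
  by have [] := dF x (lt_le_trans a0 ax).
have F1 : F 1 = 0 by rewrite FE// ln1 /ln_pade; lra.
rewrite -subr_ge0 -FE//.
case: (ltgtP 1 y) => [y1|y1|<-]; last by rewrite F1.
- have [x|c] := @MVT R F F' 1 y y1 _ (cF _ _ ltr01).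
    by rewrite in_itv/= => /andP[x1 _]; apply: dF; lra.
  rewrite in_itv/= F1 subr0 => /andP[c1 _] ->.
  by rewrite /F' mulr_ge0 ?divr_ge0 ?mulr_ge0 ?exprn_ge0//; lra.
- have [x|c] := @MVT R F F' y 1 y1 _ (cF _ _ y0).
    by rewrite in_itv/= => /andP[x1 _]; apply: dF; lra.
  rewrite in_itv/= F1 sub0r => /andP[yc c1] /(canRL (@opprK _)) ->.
  rewrite /F' -mulNr; apply: mulr_ge0; last lra.
  rewrite -mulNr; apply: divr_ge0; last by rewrite mulr_ge0 ?sqr_ge0.
  by rewrite exprS -mulNr mulr_ge0 ?sqr_ge0//; lra.
Qed.

(** Cleared of denominators, so that concrete instances only ask for integer
    arithmetic; the upper bound is the lower one for the inverse ratio. *)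
Lemma ln_ratio_bounds (R : realType) (lo hi a b : R) : 0 < a -> 0 < b ->
  lo * (2 * a * (a + 2 * b)) <= (a - b) * (5 * a + b) ->
  (a - b) * (a + 5 * b) <= hi * (2 * b * (2 * a + b)) ->
  lo <= ln a - ln b <= hi.
Proof.
have lower (c x y : R) : 0 < x -> 0 < y ->
    c * (2 * x * (x + 2 * y)) <= (x - y) * (5 * x + y) -> c <= ln x - ln y.
  move=> x0 y0 cxy; rewrite -ln_div ?posrE//.
  have xy0 : 0 < x / y by rewrite divr_gt0.
  apply: le_trans (ln_pade_le xy0).
  have -> : ln_pade (x / y) = (x - y) * (5 * x + y) / (2 * x * (x + 2 * y)).
    by rewrite /ln_pade; field; lra.
  by rewrite ler_pdivlMr// mulr_gt0//; lra.
move=> a0 b0 loab abhi; rewrite lower//= -lerN2 opprB lower//; lra.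
Qed.

(** At 0 this reads 3 / 4 <= 1, owing to the convention ln 0 = 0. *)
Lemma h_ge (R : realType) (x : R) : 0 <= x -> 3 * (x - 1) ^+ 2 / (2 * (x + 2)) <= h x.
Proof.
rewrite le_eqVlt => /orP[/eqP <-|x0].
  by rewrite /h mul0r !add0r; lra.
have := ln_pade_le x0; rewrite -(ler_pM2l x0) => xl.
have -> : 3 * (x - 1) ^+ 2 / (2 * (x + 2)) = x * ln_pade x - x + 1.
  by rewrite /ln_pade; field; lra.
by rewrite /h lerD2r lerD2r.
Qed.

Lemma h_gt0 (R : realType) (x : R) : 0 <= x -> x != 1 -> 0 < h x.
Proof.
move=> x0 x1; apply: lt_le_trans (h_ge x0).
apply: divr_gt0; last lra.
by apply: mulr_gt0 => //; rewrite exprn_even_gt0//= subr_eq0.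
Qed.

Lemma h_1 (R : realType) : h (1 : R) = 0.
Proof. by rewrite /h ln1; lra. Qed.

Lemma h_ge0 (R : realType) (x : R) : 0 <= x -> 0 <= h x.
Proof.
move=> x0; apply: le_trans (h_ge x0); apply: divr_ge0; last lra.
by apply: mulr_ge0 => //; exact: sqr_ge0.
Qed.

(** Rescaling only adds affine terms, so that the tangent inequalities at r and
    the comparison of block graphons with the constant r all come down to h
    with the point 1 as reference, where h and its derivative vanish. *)
Lemma h_scale (R : realType) (r y : R) : 0 < r -> 0 <= y ->
  h (r * y) = r * h y + ln r * (r * y - r) + h r.
Proof.
move=> r0; rewrite le_eqVlt => /orP[/eqP <-|y0].
  by rewrite /h mulr0 !mul0r; lra.
by rewrite /h lnM ?posrE//; lra.
Qed.

Lemma h_tangent_lt (R : realType) (r x : R) : 0 < r -> 0 <= x -> x != r ->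
  h r + ln r * (x - r) < h x.
Proof.
move=> r0 x0 xr.
have xE : x = r * (x / r) by rewrite mulrC divfK// gt_eqF.
have y0 : 0 <= x / r by rewrite divr_ge0// ltW.
have y1 : x / r != 1 by rewrite -[1](divff (lt0r_neq0 r0)) (inj_eq (mulIf _))// invr_eq0 gt_eqF.
rewrite [in ltRHS]xE h_scale// -xE.
have := mulr_gt0 r0 (h_gt0 y0 y1); lra.
Qed.

Lemma h_tangent_le (R : realType) (r x : R) : 0 < r -> 0 <= x ->
  h r + ln r * (x - r) <= h x.
Proof.
move=> r0 x0; have [->|xr] := eqVneq x r; first by rewrite subrr mulr0 addr0.
exact/ltW/h_tangent_lt.
Qed.

(** Bernstein's bound at x / r has denominator x + 2 r, largest at x = 1. *)
Lemma h_ge_quadratic (R : realType) (r x : R) : 0 < r -> 0 <= x <= 1 ->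
  h r + ln r * (x - r) + 3 / (4 * r + 2) * (x - r) ^+ 2 <= h x.
Proof.
move=> r0 /andP[x0 x1].
have xE : x = r * (x / r) by rewrite mulrC divfK// gt_eqF.
have y0 : 0 <= x / r by rewrite divr_ge0// ltW.
rewrite [in leRHS]xE h_scale// -xE.
have : 3 / (4 * r + 2) * (x - r) ^+ 2 <= r * h (x / r).
  apply: le_trans (ler_wpM2l (ltW r0) (h_ge y0)).
  have -> : r * (3 * (x / r - 1) ^+ 2 / (2 * (x / r + 2))) =
    3 / (2 * x + 4 * r) * (x - r) ^+ 2 by field; lra.
  apply: ler_wpM2r; first exact: sqr_ge0.
  by apply: ler_wpM2l => //; rewrite lef_pV2 ?posrE; lra.
lra.
Qed.

(** Every number needed is a combination of the logarithms of 2, 3, 5 and 7, and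
    these are determined by the ratios 9/8, 10/9, 16/15 and 15/14, which are so
    close to 1 that the rational approximation is accurate to five digits. *)
Lemma ln_numerals (R : realType) :
  [/\ 140 / 101 <= ln (4 : R), 23 / 80 <= ln (4 : R) - ln 3,
      ln (50 : R) - ln 3 <= 197 / 70, ln (2 : R) - ln 25 <= - (101 / 40) &
      ln (80 : R) <= 57 / 13] /\
  [/\ - (64 / 41) <= ln (21 / 100 : R), - (11 / 7) <= ln (209 / 10 ^+ 3 : R),
      ln (209 / 10 ^+ 3 : R) <= - (36 / 23),
      - (55 / 72) <= ln (466 / 10 ^+ 3 : R) &
      ln (467 / 10 ^+ 3 : R) <= - (51 / 67)].
Proof.
have pos2 : (2 : R) \is Num.pos by rewrite posrE.
have l4 : ln (4 : R) = 2 * ln 2.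
  by have -> : 4 = 2 ^+ 2 :> R; rewrite ?lnXn//; lra.
have l8 : ln (8 : R) = 3 * ln 2.
  by have -> : 8 = 2 ^+ 3 :> R; rewrite ?lnXn//; lra.
have l9 : ln (9 : R) = 2 * ln 3.
  by have -> : 9 = 3 ^+ 2 :> R; rewrite ?lnXn//; lra.
have l10 : ln (10 : R) = ln 2 + ln 5 by rewrite -lnM ?posrE//; congr ln; lra.
have l14 : ln (14 : R) = ln 2 + ln 7 by rewrite -lnM ?posrE//; congr ln; lra.
have l15 : ln (15 : R) = ln 3 + ln 5 by rewrite -lnM ?posrE//; congr ln; lra.
have l16 : ln (16 : R) = 4 * ln 2.
  by have -> : 16 = 2 ^+ 4 :> R; rewrite ?lnXn//; lra.
have l25 : ln (25 : R) = 2 * ln 5.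
  by have -> : 25 = 5 ^+ 2 :> R; rewrite ?lnXn//; lra.
have l80 : ln (80 : R) = 4 * ln 2 + ln 5.
  by have -> : 80 = 16 * 5 :> R; rewrite ?lnM ?posrE//; lra.
have l50 : ln (50 : R) = ln 2 + 2 * ln 5.
  by have -> : 50 = 2 * 25 :> R; rewrite ?lnM ?posrE//; lra.
have l21 : ln (21 : R) = ln 3 + ln 7.
  by have -> : 21 = 3 * 7 :> R; rewrite ?lnM ?posrE//; lra.
have l100 : ln (100 : R) = 2 * ln 2 + 2 * ln 5.
  by have -> : 100 = 4 * 25 :> R; rewrite ?lnM ?posrE//; lra.
have b1 : 53 / 450 <= ln (9 : R) - ln 8 <= 49 / 416 by clear; apply: ln_ratio_bounds; lra.
have b2 : 59 / 560 <= ln (10 : R) - ln 9 <= 55 / 522 by clear; apply: ln_ratio_bounds; lra.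
have b3 : 95 / 1472 <= ln (16 : R) - ln 15 <= 91 / 1410 by clear; apply: ln_ratio_bounds; lra.
have b4 : 89 / 1290 <= ln (15 : R) - ln 14 <= 85 / 1232 by clear; apply: ln_ratio_bounds; lra.
rewrite l9 l8 in b1.
rewrite l10 l9 in b2.
rewrite l16 l15 in b3.
rewrite l15 l14 in b4.
have l21' : ln (21 / 100 : R) = ln 21 - ln 100 by rewrite ln_div ?posrE.
have b5 : - (1 / 209) <= ln (209 / 10 ^+ 3 : R) - ln (21 / 100) <= - (1 / 210).
  by clear; apply: ln_ratio_bounds; lra.
have b6 : - (1 / 698) <= ln (466 / 10 ^+ 3 : R) - ln (7 / 15) <= 0.
  by clear; apply: ln_ratio_bounds; lra.
have b7 : 0 <= ln (467 / 10 ^+ 3 : R) - ln (7 / 15) <= 1 / 1399.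
  by clear; apply: ln_ratio_bounds; lra.
have l715 : ln (7 / 15 : R) = ln 7 - ln 15 by rewrite ln_div ?posrE.
rewrite l15 in l715; rewrite l21 l100 in l21'; rewrite l21' in b5.
rewrite l715 in b6 b7; rewrite l21' l4 l50 l80 l25.
move: (ln 2) (ln 3) (ln 5) (ln 7) (ln (209 / 10 ^+ 3)) (ln (466 / 10 ^+ 3)) (ln (467 / 10 ^+ 3))
  b1 b2 b3 b4 b5 b6 b7; clear => x2 x3 x5 x7 y209 y466 y467 b1 b2 b3 b4 b5 b6 b7.
split; first by clear b4 b5 b6 b7; split; lra.
split; lra.
Qed.

(** * The threshold rbar *)

(** Two solutions would give, with the point 1, three points of the strictly
    convex graph of h on one line: the tangent at the middle one excludes it. *)
Lemma is_rbar_unique (R : realType) (r s : R) : is_rbar r -> is_rbar s -> r = s.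
Proof.
(* a zero of the defining equation is a point where h meets the chord x |-> (1 - x) / 3 *)
have chord (x : R) : is_rbar x -> [/\ 0 < x, x < 1 & h x = (1 - x) / 3].
  by move=> [/andP[x0 x1] ex]; split=> //; rewrite /h; lra.
wlog rs : r s / r < s.
  move=> H ir js; have [rs|sr|//] := ltgtP r s; first exact: H.
  exact/esym/H.
move=> /chord[r0 r1 hr] /chord[s0 s1 hs].
have A := h_tangent_lt s0 (ltW r0) (negbT (lt_eqF rs)).
have B := h_tangent_lt s0 ler01 (negbT (gt_eqF s1)).
rewrite h_1 hs in B; rewrite hr hs in A.
have P : 0 < (s - r) * (ln s + 1 / 3) by lra.
have Q : 0 < (1 - s) * - (ln s + 1 / 3) by lra.
by move: P Q; rewrite !pmulr_rgt0 ?subr_gt0//; lra.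
Qed.

Lemma is_rbar_exists (R : realType) :
  exists2 r : R, is_rbar r & 466 / 10 ^+ 3 <= r < 467 / 10 ^+ 3.
Proof.
have [_ [_ _ _ l466 l467]] := ln_numerals R.
pose k (r : R) := 3 / 2 * r * ln r - r + 1.
have k466 : 0 <= k (466 / 10 ^+ 3) by rewrite /k; lra.
have k467 : k (467 / 10 ^+ 3) < 0 by rewrite /k; lra.
have ab : 466 / 10 ^+ 3 <= 467 / 10 ^+ 3 :> R by clear; lra.
have ck : {within `[(466 / 10 ^+ 3 : R), 467 / 10 ^+ 3], continuous k}.
  apply: continuous_in_subspaceT => /= x; rewrite inE/= in_itv/= => /andP[x0 _].
  have x1 : 0 < x by apply: lt_le_trans x0; clear; lra.
  apply: cvgD; last exact: cvg_cst.
  apply: cvgB; last exact: cvg_id.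
  apply: cvgM; last exact: continuous_ln.
  by apply: cvgM; [exact: cvg_cst|exact: cvg_id].
have [|r] := @IVT R k _ _ 0 ab ck.
  by rewrite ge_min (ltW k467) orbT/= le_max k466.
rewrite in_itv/= => /andP[r466 r467] kr0.
have r467' : r < 467 / 10 ^+ 3.
  by rewrite lt_neqAle r467 andbT; apply: contraTneq k467 => <-; rewrite kr0 ltxx.
exists r; last by rewrite r466.
by split; [apply/andP; split|rewrite -kr0 /k]; lra.
Qed.

(** * Block graphons up to scale *)

(** The off-diagonal value that goes with the diagonal value u in a block graphon
    whose triangle density is 1; it is the case r = 1 of [f_arg]. *)
Definition partner {R : realType} (u : R) : R := Num.sqrt ((4 - u ^+ 3) / (3 * u)).

Lemma partner_eq (R : realType) (u : R) : 0 < u < 1 ->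
  u ^+ 3 + 3 * u * partner u ^+ 2 = 4.
Proof.
move=> /andP[u0 u1]; rewrite sqr_sqrtr; first by field; lra.
have u3 : u ^+ 3 <= 1 by rewrite exprn_ile1// ltW.
by apply: divr_ge0; lra.
Qed.

Lemma partner_gt1 (R : realType) (u : R) : 0 < u < 1 -> 1 < partner u.
Proof.
move=> /andP[u0 u1]; rewrite -sqrtr1 ltr_sqrt.
  rewrite ltr_pdivlMr; last by lra.
  have : u ^+ 3 < u by rewrite -[ltRHS]expr1 ltr_iXn2l.
  by lra.
apply: divr_gt0; last by lra.
have u3 : u ^+ 3 <= 1 by rewrite exprn_ile1// ltW.
lra.
Qed.

(** The two eigenvalues of the block graphon, half the sum and minus half the
    difference of the two values, have cubes adding up to 1. *)
Lemma partner_cubes (R : realType) (u : R) : 0 < u < 1 ->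
  (u + partner u) ^+ 3 = 8 + (partner u - u) ^+ 3.
Proof. by move=> /partner_eq; nra. Qed.

Lemma add_partner_gt2 (R : realType) (u : R) : 0 < u < 1 -> 2 < u + partner u.
Proof.
move=> uI; have e := partner_cubes uI; have v1 := partner_gt1 uI.
have /andP[u0 u1] := uI.
have c : 0 < (partner u - u) ^+ 3 by rewrite exprn_gt0//; lra.
rewrite -(@ltr_pXn2r _ 3)// ?nnegrE; lra.
Qed.

(** With L = ln s this is f_s(s u) without its positive factor s / 2. *)
Definition scaled_f {R : realType} (L u : R) : R :=
  h u + h (partner u) + L * (u + partner u - 2).

Lemma f_arg_scale (R : realType) (s u : R) : 0 < s -> 0 < u ->
  f_arg s (s * u) = s * partner u.
Proof.
move=> s0 u0; rewrite /f_arg /partner.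
have -> : (4 * s ^+ 3 - (s * u) ^+ 3) / (3 * (s * u)) = s ^+ 2 * ((4 - u ^+ 3) / (3 * u)).
  by field; lra.
by rewrite sqrtrM ?sqr_ge0// sqrtr_sqr gtr0_norm.
Qed.

Lemma f_r_scale (R : realType) (s u : R) : 0 < s -> 0 < u ->
  f_r s (s * u) = s / 2 * scaled_f (ln s) u.
Proof.
move=> s0 u0; rewrite /f_r f_arg_scale// /scaled_f !h_scale ?sqrtr_ge0//; last exact: ltW.
lra.
Qed.

Lemma f_has_zeroP (R : realType) (s : R) : 0 < s ->
  f_has_zero s <-> exists u : R, [/\ 0 < u < 1, s * partner u <= 1 & scaled_f (ln s) u = 0].
Proof.
move=> s0; have s2 : s / 2 != 0 by lra.
split=> [[x [/andP[x0 xs] y1 fx]]|[u [/andP[u0 u1] v1 g0]]].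
  have xE : x = s * (x / s) by rewrite mulrC divfK// gt_eqF.
  have u0 : 0 < x / s by rewrite divr_gt0.
  exists (x / s); split; first by rewrite u0 ltr_pdivrMr// mul1r.
    by rewrite -f_arg_scale// -xE.
  have := f_r_scale s0 u0; rewrite -xE fx => /esym/eqP.
  by rewrite mulf_eq0 (negbTE s2) => /eqP.
exists (s * u); split; last by rewrite f_r_scale// g0 mulr0.
- by rewrite mulr_gt0//= gtr_pMr.
- by rewrite f_arg_scale.
Qed.

(** Near the constant graphon, u + v - 2 is of third order in v - u by
    [partner_cubes], whereas h(u) + h(v) is of second order. *)
Lemma scaled_f_gt0_near1 (R : realType) (L u : R) : 0 < u < 1 -> partner u <= 3 / 2 ->
  - (11 / 7) <= L -> 0 < scaled_f L u.
Proof.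
move=> uI v2 L0; rewrite /scaled_f.
have /andP[u0 u1] := uI.
have u1' : 0 <= 1 - u by lra.
have v1 := partner_gt1 uI; have a0 := add_partner_gt2 uI.
have cub := partner_cubes uI.
set v := partner u in v1 v2 a0 cub *.
have hu : (1 - u) ^+ 2 / 2 <= h u.
  apply: le_trans (h_ge (ltW u0)); rewrite ler_pdivlMr; last lra.
  have := mulr_ge0 (sqr_ge0 (1 - u)) u1'; lra.
have hv : 3 / 7 * (v - 1) ^+ 2 <= h v.
  have v0 : 0 <= v by lra.
  apply: le_trans (h_ge v0); rewrite ler_pdivlMr; last lra.
  have v3 : 0 <= 3 / 2 - v by lra.
  have := mulr_ge0 (sqr_ge0 (v - 1)) v3; lra.
pose a := u + v - 2; pose b := v - u.
have b0 : 0 < b by rewrite /b; lra.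
have b1 : b < 1 by rewrite /b; lra.
have ab : 12 * a <= b ^+ 2.
  have e : (2 + a) ^+ 3 = 8 + b ^+ 3 by rewrite -cub /a; congr (_ ^+ 3); lra.
  have b3 : b ^+ 3 <= b ^+ 2 by rewrite -(ler_pM2l b0) in b1 *; nra.
  have a1 : 0 < a by rewrite /a; lra.
  by nra.
have La : - (11 / 7) * a <= L * a by rewrite ler_pM2r// /a; lra.
have b2 : 0 < b ^+ 2 by rewrite exprn_gt0.
have uv : b ^+ 2 / 2 <= (1 - u) ^+ 2 + (v - 1) ^+ 2.
  have := sqr_ge0 (u + v - 2); rewrite /b; lra.
have := sqr_ge0 (1 - u); rewrite -/a; lra.
Qed.

(** What [scaled_f_gt0] comes down to.  The minimum, about 3, is attained close to
    v = 4 and leaves little room; the certificates of positivity are therefore in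
    powers of v - 4 above 4, of 4 - v and v - 2 between 2 and 4, and of v - 3 / 2
    and 2 - v below 2. *)
Lemma quintic_gt0 (R : realType) (v : R) : 3 / 2 <= v ->
  0 < (140 / 101 * (2 * v * (v + 8)) + (v - 4) * (5 * v + 4)) * (v ^+ 3 - 8 / 3) +
      (4 / 3 * (23 / 80) - (1 + 64 / 41) * (v ^+ 3 - 2 * v ^+ 2 + 4 / 3)) * (2 * v * (v + 8)).
Proof.
move=> v1.
have [v4|v4] := leP 4 v.
  have w0 : 0 <= v - 4 by lra.
  have := (sqr_ge0 ((v - 4) - 1 / 30), exprn_ge0 3 w0, exprn_ge0 4 w0, exprn_ge0 5 w0).
  by clear -w0; move=> [[[p2 p3] p4] p5]; lra.
have [v3|v3] := leP 2 v.
  have t0 : 0 <= v - 2 by lra.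
  (* write the quintic as a + b w + w ^ 2 c(w) with w = 4 - v; the cubic c has
     positive coefficients in 2 - w = v - 2 *)
  have w2 := sqr_ge0 (4 - v).
  have := (mulr_ge0 w2 t0, mulr_ge0 w2 (exprn_ge0 2 t0), mulr_ge0 w2 (exprn_ge0 3 t0)).
  by clear -v4 w2; move=> [[p2 p3] p4]; lra.
have t0 : 0 <= v - 3 / 2 by lra.
have t1 : 0 <= 2 - v by lra.
have := (mulr_ge0 (exprn_ge0 2 t0) t1, mulr_ge0 (exprn_ge0 3 t0) t1, sqr_ge0 (v - 3 / 2),
         exprn_ge0 5 t0).
by clear -t0; move=> [[[p2 p3] p4] p5]; lra.
Qed.

(** At L = ln 0.21 the minimum over u, attained near u = 0.08, is barely positive:
    this is what places runder below 0.21.  The constraint gives 3 u v ^ 2 <= 4,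
    and replacing u by 4 / (3 v ^ 2) costs little away from u = 1: it leaves an
    inequality in v where ln v occurs once, with a positive factor v ^ 3 - 8 / 3,
    and the rational lower bound of ln (v / 4) makes it polynomial. *)
Lemma scaled_f_gt0 (R : realType) (L u : R) : 0 < u < 1 -> - (64 / 41) <= L ->
  0 < scaled_f L u.
Proof.
move=> uI L0; have [v3|v3] := leP (partner u) (3 / 2).
  by apply: scaled_f_gt0_near1 => //; clear -L0; lra.
wlog L1 : L L0 / L <= 0.
  move=> H; have [/H->//|/ltW L1] := leP L 0.
  have := H 0; rewrite /scaled_f lexx mul0r => H0.
  apply: lt_le_trans (H0 _ isT) _; first by clear; lra.
  rewrite lerD2l mulr_ge0// subr_ge0 ltW//; exact: add_partner_gt2.
have /andP[u0 u1] := uI; have e := partner_eq uI.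
rewrite /scaled_f; set v := partner u in v3 e *.
have v0 : 0 < v by lra.
have v20 : 0 < v ^+ 2 by rewrite exprn_gt0.
pose w := 4 / (3 * v ^+ 2).
have w0 : 0 < w by rewrite /w divr_gt0// mulr_gt0.
have uw : u <= w.
  rewrite /w ler_pdivlMr ?mulr_gt0//.
  have := exprn_ge0 3 (ltW u0); lra.
have v2 : 9 / 4 < v ^+ 2 by nra.
have w1 : w <= 1 by rewrite /w ler_pdivrMr; lra.
(* replacing u by w is harmless as t |-> h t + L * t is convex and decreasing on [0, 1] *)
have huw : h w + L * w <= h u + L * u.
  have := h_tangent_le w0 (ltW u0).
  have lw := ln_le0 w1.
  have : 0 <= (ln w + L) * (u - w) by rewrite mulr_le0//; lra.
  lra.
suff : 0 < h v + h w + L * (v + w - 2) by lra.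
have lnw : ln w = ln 4 - ln 3 - 2 * ln v.
  rewrite /w ln_div ?posrE ?mulr_gt0// lnM ?posrE// lnXn//; lra.
have lnv : ln 4 + (v - 4) * (5 * v + 4) / (2 * v * (v + 8)) <= ln v.
  have v40 : 0 < v / 4 by lra.
  have := ln_pade_le v40; rewrite ln_div ?posrE//.
  have -> : ln_pade (v / 4) = (v - 4) * (5 * v + 4) / (2 * v * (v + 8)).
    by rewrite /ln_pade; field; lra.
  lra.
have [[l4 l43 _ _ _] _] := ln_numerals R.
have vv0 : 0 < 2 * v * (v + 8) by rewrite mulr_gt0//; lra.
have lnv' : 140 / 101 * (2 * v * (v + 8)) + (v - 4) * (5 * v + 4) <= ln v * (2 * v * (v + 8)).
  rewrite -ler_pdivrMr//; apply: le_trans lnv.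
  by rewrite mulrDl mulfK ?gt_eqF// lerD2r.
have v30 : 0 < v ^+ 3 - 8 / 3 by rewrite exprS; nra.
have cub0 : 0 <= v ^+ 3 - 2 * v ^+ 2 + 4 / 3.
  have := mulr_ge0 (sqr_ge0 (v - 4 / 3)) (ltW v0); have := sqr_ge0 (v - 1); nra.
have -> : h v + h w + L * (v + w - 2) =
  (ln v * (v ^+ 3 - 8 / 3) + 4 / 3 * (ln 4 - ln 3) -
     (1 - L) * (v ^+ 3 - 2 * v ^+ 2 + 4 / 3)) / v ^+ 2.
  by rewrite /h lnw /w; field; lra.
rewrite divr_gt0// -(pmulr_lgt0 _ vv0).
apply: lt_le_trans (quintic_gt0 (ltW v3)) _.
have A := ler_wpM2r (ltW v30) lnv'.
have B : (4 / 3 * (23 / 80) - (1 + 64 / 41) * (v ^+ 3 - 2 * v ^+ 2 + 4 / 3)) *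
    (2 * v * (v + 8)) <=
  (4 / 3 * (ln 4 - ln 3) - (1 - L) * (v ^+ 3 - 2 * v ^+ 2 + 4 / 3)) * (2 * v * (v + 8)).
  rewrite ler_pM2r//.
  have : (1 - L) * (v ^+ 3 - 2 * v ^+ 2 + 4 / 3) <=
         (1 + 64 / 41) * (v ^+ 3 - 2 * v ^+ 2 + 4 / 3) by rewrite ler_wpM2r//; lra.
  lra.
apply: le_trans (lerD A B) _.
rewrite le_eqVlt; apply/orP; left; apply/eqP; ring.
Qed.

(** For tiny u the side condition s v <= 1 confines s u, so that the diagonal
    blocks alone already cost more than the constant: h(s u) / 2 > h(s). *)
Lemma scaled_f_gt0_far (R : realType) (s u : R) : 0 < u < 59 / 10 ^+ 3 ->
  209 / 10 ^+ 3 <= s -> s * partner u <= 1 -> 0 < scaled_f (ln s) u.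
Proof.
move=> /andP[u0 u1] s1 sv1.
have s0 : 0 < s by apply: lt_le_trans s1; clear; lra.
have uI : 0 < u < 1 by rewrite u0/=; clear -u1; lra.
suff : 0 < s / 2 * scaled_f (ln s) u by rewrite pmulr_rgt0// divr_gt0.
rewrite -f_r_scale// /f_r f_arg_scale//.
have [[_ _ _ _ l80] [_ _ l209 _ _]] := ln_numerals R.
have e := partner_eq uI; have v1 := partner_gt1 uI.
set v := partner u in sv1 e v1 *.
have v2 : 19 / 4 < v.
  have v0 : 0 <= v by clear -v1; lra.
  have c0 : 0 <= 19 / 4 :> R by clear; lra.
  rewrite -(@ltr_pXn2r _ 2) ?nnegrE//.
  have : u ^+ 3 <= u by rewrite -[leRHS]expr1 ler_wiXn2l//; clear -u1 u0; lra.
  clear -e u0 u1; nra.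
have hv : 0 <= h (s * v) by rewrite h_ge0// mulr_ge0; clear -v1 s0; lra.
have s2 : s <= 4 / 19.
  rewrite -(ler_pM2r (_ : 0 < 19 / 4)); last by clear; lra.
  by clear -v2 sv1 s0; nra.
have su : s * u <= 1 / 80 by clear -s2 u1 s0 u0; nra.
have su0 : 0 < s * u by rewrite mulr_gt0.
have hs : h s <= 4639 / 10 ^+ 4.
  have b0 : 0 < 209 / 10 ^+ 3 :> R by clear; lra.
  have ls : ln s <= 0 by apply: ln_le0; clear -s2; lra.
  have : 0 <= ln s * (209 / 10 ^+ 3 - s) by rewrite mulr_le0//; clear -s1; lra.
  have := h_tangent_le s0 (ltW b0).
  rewrite [h (209 / _)]/h; clear -l209; lra.
have hsu : 932 / 10 ^+ 3 <= h (s * u).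
  have b0 : 0 < 80^-1 :> R by clear; lra.
  have lb : ln (80^-1 : R) = - ln 80 by rewrite lnV// posrE.
  have : 0 <= ln (80^-1 : R) * (s * u - 80^-1).
    by rewrite lb mulr_le0 ?oppr_le0 ?ln_ge0//; [clear; lra|clear -su; lra].
  have := h_tangent_le b0 (ltW su0).
  rewrite [h 80^-1]/h lb; clear -l80; lra.
by clear -hs hsu hv; lra.
Qed.

(** The point u = 2 / 25 is close to the maximizer of [zero_scale], and witnesses
    that runder is at least 0.209. *)
Lemma scaled_f_le0_at (R : realType) : scaled_f (ln (209 / 10 ^+ 3)) (2 / 25 : R) <= 0.
Proof.
have [[_ _ l50 l25 _] [_ _ l209 _ _]] := ln_numerals R.
have uI : 0 < (2 / 25 : R) < 1 by apply/andP; split; clear; lra.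
have e := partner_eq uI; have v1 := partner_gt1 uI.
rewrite /scaled_f; set v := partner _ in e v1 *.
have v0 : 0 < v by clear -v1; lra.
have v2 : v ^+ 2 <= 50 / 3 by clear -e; lra.
have v4 : 102 / 25 <= v.
  rewrite leNgt; apply/negP => v4.
  have : v ^+ 2 < (102 / 25) ^+ 2 by rewrite ltr_pXn2r ?nnegrE//; clear -v0; lra.
  by clear -e; lra.
have lnv : ln v <= 197 / 140.
  have : ln (v ^+ 2) <= ln (50 / 3) by rewrite ler_ln ?posrE ?exprn_gt0//; clear; lra.
  rewrite lnXn// ln_div ?posrE//; clear -l50; lra.
have hu : h (2 / 25 : R) <= 359 / 500.
  by rewrite /h ln_div ?posrE//; clear -l25; lra.
have hv : h v <= v * (197 / 140) - v + 1.
  by rewrite /h; have : v * ln v <= v * (197 / 140); [rewrite ler_pM2l|lra].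
have : ln (209 / 10 ^+ 3) * (2 / 25 + v - 2) <= - (36 / 23) * (2 / 25 + v - 2).
  by rewrite ler_wpM2r//; clear -v4; lra.
by clear -hu hv v4; lra.
Qed.

(** * The threshold runder *)

(** The scale at which the block graphon of shape u ties with the constant. *)
Definition zero_scale {R : realType} (u : R) : R :=
  expR (- ((h u + h (partner u)) / (u + partner u - 2))).

Lemma ln_zero_scale (R : realType) (u : R) :
  ln (zero_scale u) = - ((h u + h (partner u)) / (u + partner u - 2)).
Proof. exact: expRK. Qed.

Lemma scaled_f_zero_scale (R : realType) (L u : R) : 0 < u < 1 ->
  scaled_f L u = (L - ln (zero_scale u)) * (u + partner u - 2).
Proof.
move=> uI; have a0 := add_partner_gt2 uI.
by rewrite ln_zero_scale /scaled_f; field; lra.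
Qed.

Lemma scaled_f_eq0 (R : realType) (s u : R) : 0 < u < 1 -> 0 < s ->
  scaled_f (ln s) u = 0 <-> s = zero_scale u.
Proof.
move=> uI s0; have a0 := add_partner_gt2 uI.
rewrite scaled_f_zero_scale//; split=> [/eqP|<-]; last by rewrite subrr mul0r.
rewrite mulf_eq0 subr_eq0 orbC gt_eqF; last by lra.
by move=> /eqP /ln_inj; apply; rewrite posrE// expR_gt0.
Qed.

Lemma zero_scale_continuous (R : realType) (u : R) : 0 < u < 1 ->
  {for u, continuous zero_scale}.
Proof.
move=> uI; have a0 := add_partner_gt2 uI; have v1 := partner_gt1 uI.
have /andP[u0 u1] := uI.
have ch (x : R) : 0 < x -> {for x, continuous (@h R)}.
  move=> x0; apply: cvgD; last exact: cvg_cst.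
  apply: cvgB; last exact: cvg_id.
  by apply: cvgM; [exact: cvg_id|exact: continuous_ln].
have cp : {for u, continuous (@partner R)}.
  apply: (@continuous_comp _ _ _ (fun u : R => (4 - u ^+ 3) / (3 * u)) Num.sqrt).
    apply: cvgM.
      by apply: cvgB; [exact: cvg_cst|exact: exprn_continuous].
    apply: cvgV; first by lra.
    by apply: cvgM; [exact: cvg_cst|exact: cvg_id].
  exact: sqrt_continuous.
apply: (@continuous_comp _ _ _ _ expR); last exact: continuous_expR.
apply: cvgN; apply: cvgM.
  apply: cvgD; first exact: ch.
  by apply: (@continuous_comp _ _ _ (@partner R) h) => //; apply: ch; lra.
apply: cvgV; first by lra.
apply: cvgB; last exact: cvg_cst.
by apply: cvgD; [exact: cvg_id|].
Qed.

(** Below u = 59 / 1000 there is no zero with s >= 0.209 by [scaled_f_gt0_far], and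
    beyond 9 / 10 none by [scaled_f_gt0_near1]; in between v <= 100 / 21, so that
    s < 21 / 100 gives s v <= 1 and the maximum over the interval is a genuine
    zero. *)
Lemma is_runder_exists (R : realType) :
  exists2 r : R, is_runder r & 209 / 10 ^+ 3 <= r < 210 / 10 ^+ 3.
Proof.
have [_ [l21 l209 _ _ _]] := ln_numerals R.
have s0 : 0 < 209 / 10 ^+ 3 :> R by clear; lra.
have s1 : 0 < 21 / 100 :> R by clear; lra.
have cz : {within `[(59 / 10 ^+ 3 : R), 9 / 10], continuous zero_scale}.
  apply: continuous_in_subspaceT => /= u; rewrite inE/= in_itv/= => /andP[u0 u1].
  by apply: zero_scale_continuous; clear -u0 u1; lra.
have ab : 59 / 10 ^+ 3 <= 9 / 10 :> R by clear; lra.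
have [c] := EVT_max ab cz.
rewrite in_itv/= => /andP[c0 c1] cmax.
have cI : 0 < c < 1 by clear -c0 c1; lra.
have rlow : 209 / 10 ^+ 3 <= zero_scale c.
  have uI : 0 < (2 / 25 : R) < 1 by apply/andP; split; clear; lra.
  apply: (@le_trans _ _ (zero_scale (2 / 25))); last first.
    by apply: cmax; rewrite in_itv/=; clear; lra.
  have := scaled_f_le0_at R; have a0 := add_partner_gt2 uI.
  rewrite scaled_f_zero_scale// pmulr_lle0; last by rewrite subr_gt0.
  by rewrite subr_le0 ler_ln ?posrE ?expR_gt0.
have rup : zero_scale c < 21 / 100.
  have := scaled_f_gt0 cI l21; have a0 := add_partner_gt2 cI.
  rewrite scaled_f_zero_scale// pmulr_lgt0; last by rewrite subr_gt0.
  by rewrite subr_gt0 ltr_ln ?posrE ?expR_gt0.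
have pc : partner c <= 100 / 21.
  have e := partner_eq cI; have v1 := partner_gt1 cI.
  rewrite leNgt; apply/negP => vc.
  have : (100 / 21) ^+ 2 < partner c ^+ 2.
    by rewrite ltr_pXn2r ?nnegrE//; clear -v1; lra.
  have := exprn_ge0 3 (ltW (andP cI).1).
  have : 0 <= (c - 59 / 10 ^+ 3) * partner c ^+ 2 by rewrite mulr_ge0 ?sqr_ge0 ?subr_ge0.
  by clear -e; lra.
have r0 : 0 < zero_scale c by rewrite expR_gt0.
exists (zero_scale c); last first.
  rewrite rlow/=; apply: lt_le_trans rup _; clear; lra.
split=> [|s [/andP[t0 t1] /(f_has_zeroP t0)[u [uI sv1 /(scaled_f_eq0 uI t0) su]]]].
  split; first by rewrite r0/=; apply: lt_trans rup _; clear; lra.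
  apply/f_has_zeroP => //; exists c; split=> //; last exact/scaled_f_eq0.
  apply: (@le_trans _ _ (21 / 100 * (100 / 21))); last by clear; lra.
  by rewrite ler_pM ?sqrtr_ge0// ltW.
have [slow|slow] := leP s (209 / 10 ^+ 3); first exact: le_trans rlow.
have /andP[u0 u1] := uI.
have [ua|ua] := ltP u (59 / 10 ^+ 3).
  have := @scaled_f_gt0_far _ s u; rewrite u0 ua => /(_ isT (ltW slow) sv1).
  by have /scaled_f_eq0 -> := su; rewrite ?ltxx.
have [ub|ub] := leP u (9 / 10).
  by rewrite su; apply: cmax; rewrite in_itv/= ua.
have : 0 < scaled_f (ln s) u.
  apply: scaled_f_gt0_near1 => //.
    have e := partner_eq uI; have v1 := partner_gt1 uI.
    rewrite leNgt; apply/negP => vc.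
    have : (3 / 2) ^+ 2 < partner u ^+ 2.
      by rewrite ltr_pXn2r ?nnegrE//; clear -v1; lra.
    have := exprn_ge0 3 (ltW u0).
    have : 0 <= (u - 9 / 10) * partner u ^+ 2 by rewrite mulr_ge0 ?sqr_ge0// subr_ge0 ltW.
    by clear -e; lra.
  apply: le_trans l209 _; rewrite ler_ln ?posrE// ltW//.
by have /scaled_f_eq0 -> := su; rewrite ?ltxx.
Qed.

(** * The trade-off between mean and variance *)

(** For r >= 1/2 the bound - r ln r <= 1 - r suffices; below, - ln r is at most
    - ln 0.466, and the rest is a quadratic inequality. *)
Lemma entropy_beats_slope (R : realType) (r : R) : 466 / 10 ^+ 3 <= r <= 1 ->
  Num.max r (1 - r) * - ln r * (4 * r + 2) < 9 * r ^+ 2.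
Proof.
move=> /andP[r466 r1].
have r0 : 0 < r by apply: lt_le_trans r466; clear; lra.
have L0 : 0 <= - ln r by rewrite oppr_ge0 ln_le0.
have [rh|rh] := leP (1 / 2) r.
  rewrite max_l; last by clear -rh; lra.
  have Lr : - ln r * r <= 1 - r.
    have := h_ge0 (ltW r0); rewrite /h; clear; lra.
  apply: (@le_lt_trans _ _ ((1 - r) * (4 * r + 2))).
    by rewrite ler_pM2r ?[r * _]mulrC//; clear -r0; lra.
  by clear -rh; nra.
rewrite max_r; last by clear -rh; lra.
have [_ [_ _ _ l466 _]] := ln_numerals R.
have Lr : - ln r <= 55 / 72.
  have b0 : 0 < 466 / 10 ^+ 3 :> R by clear; lra.
  have : ln (466 / 10 ^+ 3) <= ln r by rewrite ler_ln ?posrE.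
  by clear -l466; lra.
apply: (@le_lt_trans _ _ ((1 - r) * (55 / 72) * (4 * r + 2))).
  rewrite ler_pM2r; last by clear -r0; lra.
  by rewrite ler_wpM2l//; clear -r1; lra.
have r46 : 46 / 100 <= r by clear -r466; lra.
by clear -r46 rh; nra.
Qed.

(** Only d > 0 needs an argument: then q >= 3 r ^ 2 d / K, and
    [entropy_beats_slope] compares the resulting second order gain with the
    first order loss. *)
Lemma slope_dominated (R : realType) (r d q : R) : 466 / 10 ^+ 3 <= r <= 1 -> 0 <= q ->
  3 * r ^+ 2 * d <= Num.max r (1 - r) * q ->
  q = 0 /\ 0 <= ln r * d \/ 0 < ln r * d + 3 / (4 * r + 2) * q.
Proof.
move=> r46 q0 T; have num := entropy_beats_slope r46.
have /andP[r466 r1] := r46.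
have r0 : 0 < r by apply: lt_le_trans r466; clear; lra.
have K1 : r <= Num.max r (1 - r) by rewrite le_max lexx.
set K := Num.max r (1 - r) in num K1 T.
have K0 : 0 < K by clear -K1 r0; lra.
have L0 : ln r <= 0 by exact: ln_le0.
have c0 : 0 < 3 / (4 * r + 2) by apply: divr_gt0; clear -r0; lra.
have [d0|d0] := leP d 0.
  have ld : 0 <= ln r * d by rewrite mulr_le0.
  move: q0; rewrite le_eqVlt => /orP[/eqP <-|q0]; first by left.
  by right; rewrite ltr_wpDl// mulr_gt0.
right; rewrite ltNge; apply/negP => E.
have e : 3 / (4 * r + 2) * (4 * r + 2) = 3 by clear -r0; field; lra.
have A : 3 * q <= - ln r * d * (4 * r + 2).
  rewrite -[in leLHS]e mulrAC ler_pM2r; clear -E r0; lra.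
have B : 3 * (3 * r ^+ 2 * d) <= K * (- ln r * d * (4 * r + 2)).
  have := ler_wpM2l (ltW K0) A; clear -T; lra.
have : K * - ln r * (4 * r + 2) * d < 9 * r ^+ 2 * d by rewrite ltr_pM2r.
by clear -B => C; lra.
Qed.

(** * Fubini for bounded functions on finite rectangles *)

Lemma integrable_bounded (d : measure_display) (T : measurableType d) (R : realType)
    (mu : {measure set T -> \bar R}) (A : set T) (f : T -> R) (M : R) :
  measurable A -> (mu A < +oo)%E -> measurable_fun A f ->
  (forall x, A x -> `|f x| <= M) -> mu.-integrable A (EFin \o f).
Proof.
move=> mA Aoo mf fM; apply: measurable_bounded_integrable => //.
exists M; split; first exact: num_real.
by move=> N MN p /= /fM /le_trans; apply; exact: ltW.
Qed.

Section fubini_bounded.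
Context (d1 d2 : measure_display) (T1 : measurableType d1) (T2 : measurableType d2)
  (R : realType) (m1 : {sigma_finite_measure set T1 -> \bar R})
  (m2 : {sigma_finite_measure set T2 -> \bar R})
  (A : set T1) (B : set T2) (f : T1 * T2 -> R) (M : R)
  (mA : measurable A) (mB : measurable B)
  (Aoo : (m1 A < +oo)%E) (Boo : (m2 B < +oo)%E)
  (mf : measurable_fun (A `*` B) f)
  (fM : forall p, (A `*` B) p -> `|f p| <= M).

(* extension by 0, to which Fubini on the whole product applies *)
Let g := f \_ (A `*` B).

Let mAB : measurable (A `*` B). Proof. exact: measurableX. Qed.

Let mg : measurable_fun setT g.
Proof. exact/(measurable_restrictT _ mAB). Qed.

Lemma product_measure_fin : ((m1 \x m2)%E (A `*` B) < +oo)%E.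
Proof. by rewrite product_measure1E// lte_mul_pinfty// ge0_fin_numE. Qed.

Let ig : (m1 \x m2)%E.-integrable setT (EFin \o g).
Proof.
have : (m1 \x m2)%E.-integrable (A `*` B) (EFin \o f).
  exact: (integrable_bounded mAB product_measure_fin mf fM).
by rewrite integrable_mkcond// restrict_EFin.
Qed.

Lemma measurable_section1 (x : T1) : A x -> measurable_fun B (fun y => f (x, y)).
Proof.
move=> Ax; apply/(measurable_restrictT _ mB).
have -> : (fun y => f (x, y)) \_ B = (fun y => g (x, y)).
  apply/funext => y; rewrite /g /patch; congr (if _ then _ else _).
  by apply/idP/idP; rewrite !inE //= => -[].
exact: (measurableT_comp mg (measurable_pair1 x)).
Qed.

Lemma measurable_section2 (y : T2) : B y -> measurable_fun A (fun x => f (x, y)).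
Proof.
move=> By; apply/(measurable_restrictT _ mA).
have -> : (fun x => f (x, y)) \_ A = (fun x => g (x, y)).
  apply/funext => x; rewrite /g /patch; congr (if _ then _ else _).
  by apply/idP/idP; rewrite !inE //= => -[].
exact: (measurableT_comp mg (measurable_pair2 y)).
Qed.

Let fubini_FE : fubini_F m2 (EFin \o g) =
  EFin \o ((fun x => \int[m2]_(y in B) f (x, y)) \_ A).
Proof.
apply/funext => x; rewrite /fubini_F /= [in RHS]/patch; case: ifPn => [|]; last first.
  move=> /negP; rewrite inE => nAx; rewrite integral0_eq// => y _.
  by rewrite /g patchE; case: ifPn => //; rewrite inE => -[].
rewrite inE => Ax; have im := integrable_bounded mB Boo (measurable_section1 Ax)
  (fun y By => fM (conj Ax By : (A `*` B) (x, y))).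
rewrite /Rintegral fineK; last exact: integrable_fin_num im.
rewrite [RHS]integral_mkcond; apply: eq_integral => y _.
rewrite /g !patchE; case: ifPn => [|/negP]; rewrite inE => xy; case: ifPn => [|/negP];
  rewrite inE => // By; [by case: By; case: xy|by case: xy].
Qed.

Let fubini_GE : fubini_G m1 (EFin \o g) =
  EFin \o ((fun y => \int[m1]_(x in A) f (x, y)) \_ B).
Proof.
apply/funext => y; rewrite /fubini_G /= [in RHS]/patch; case: ifPn => [|]; last first.
  move=> /negP; rewrite inE => nBy; rewrite integral0_eq// => x _.
  by rewrite /g patchE; case: ifPn => //; rewrite inE => -[].
rewrite inE => By; have im := integrable_bounded mA Aoo (measurable_section2 By)
  (fun x Ax => fM (conj Ax By : (A `*` B) (x, y))).
rewrite /Rintegral fineK; last exact: integrable_fin_num im.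
rewrite [RHS]integral_mkcond; apply: eq_integral => x _.
rewrite /g !patchE; case: ifPn => [|/negP]; rewrite inE => xy; case: ifPn => [|/negP];
  rewrite inE => // Ax; [by case: Ax; case: xy|by case: xy].
Qed.

Lemma measurable_Rintegral_section : measurable_fun A (fun x => \int[m2]_(y in B) f (x, y)).
Proof.
apply/(measurable_restrictT _ mA)/measurable_EFinP; rewrite -fubini_FE.
exact: (measurable_fubini_F ig).
Qed.

Lemma Rintegral_prod12 : \int[(m1 \x m2)%E]_(p in A `*` B) f p =
  \int[m1]_(x in A) \int[m2]_(y in B) f (x, y).
Proof.
rewrite Rintegral_mkcond [RHS]Rintegral_mkcond /Rintegral; congr fine.
by rewrite -(integral12_prod_meas1 ig) fubini_FE.
Qed.

Lemma Rintegral_prod21 : \int[(m1 \x m2)%E]_(p in A `*` B) f p =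
  \int[m2]_(y in B) \int[m1]_(x in A) f (x, y).
Proof.
rewrite Rintegral_mkcond [RHS]Rintegral_mkcond /Rintegral; congr fine.
by rewrite -(integral21_prod_meas1 ig) fubini_GE.
Qed.

End fubini_bounded.

(** Needed to iterate Fubini over triples, the square being the first factor. *)
Lemma sigma_finite_product (d1 d2 : measure_display) (T1 : measurableType d1)
    (T2 : measurableType d2) (R : realType) (m1 : {sigma_finite_measure set T1 -> \bar R})
    (m2 : {sigma_finite_measure set T2 -> \bar R}) : sigma_finite setT (m1 \x m2)%E.
Proof.
have /sigma_finiteP[F [FT F_nd F_oo]] := sigma_finiteT m1.
have /sigma_finiteP[G [GT G_nd G_oo]] := sigma_finiteT m2.
exists (fun n => F n `*` G n).
  apply/esym/seteqP; split=> // -[x y] _.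
  have [i _ Fix] : (\bigcup_k F k) x by rewrite -FT.
  have [j _ Gjy] : (\bigcup_k G k) y by rewrite -GT.
  exists (maxn i j) => //; split.
    by have /subsetPset := F_nd _ _ (leq_maxl i j); apply.
  by have /subsetPset := G_nd _ _ (leq_maxr i j); apply.
move=> n; have [mF Foo] := F_oo n; have [mG Goo] := G_oo n.
split; first exact: measurableX.
exact: product_measure_fin.
Qed.

Section sigma_finite_product_measure.
Context (d1 d2 : measure_display) (T1 : measurableType d1) (T2 : measurableType d2)
  (R : realType) (m1 : {sigma_finite_measure set T1 -> \bar R})
  (m2 : {sigma_finite_measure set T2 -> \bar R}).

(** A name for the product measure, convertible to it, that carries the
    sigma-finite structure. *)
Definition sigma_finite_prod : set (T1 * T2)%type -> \bar R := (m1 \x m2)%E.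

HB.instance Definition _ := Measure.on sigma_finite_prod.
HB.instance Definition _ :=
  Measure_isSigmaFinite.Build _ _ _ sigma_finite_prod (sigma_finite_product m1 m2).

End sigma_finite_product_measure.

(** * Means of bounded measurable functions *)

(** On a set of measure 1 this class is closed under all the operations used and
    consists of integrable functions, so that means behave linearly. *)
Definition bounded_mfun {d : measure_display} {T : measurableType d} {R : realType}
    (A : set T) (f : T -> R) : Prop :=
  measurable_fun A f /\ exists M : R, forall x, A x -> `|f x| <= M.

Section bounded_mfun_theory.
Context (d : measure_display) (T : measurableType d) (R : realType) (A : set T).
Implicit Types f g : T -> R.

Lemma bounded_mfun_cst (c : R) : bounded_mfun A (fun=> c).
Proof. by split; [exact: measurable_cst|exists `|c|]. Qed.

Lemma bounded_mfunD f g : bounded_mfun A f -> bounded_mfun A g ->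
  bounded_mfun A (fun x => f x + g x).
Proof.
move=> [mf [M fM]] [mg [N gN]]; split; first exact: measurable_funD.
by exists (M + N) => x Ax; rewrite (le_trans (ler_normD _ _))// lerD ?fM ?gN.
Qed.

Lemma bounded_mfunM f g : bounded_mfun A f -> bounded_mfun A g ->
  bounded_mfun A (fun x => f x * g x).
Proof.
move=> [mf [M fM]] [mg [N gN]]; split; first exact: measurable_funM.
by exists (M * N) => x Ax; rewrite normrM ler_pM ?fM ?gN.
Qed.

Lemma bounded_mfun_comp (d' : measure_display) (T' : measurableType d') (B : set T')
    (k : T' -> T) f : measurable A -> measurable_fun B k -> (forall x, B x -> A (k x)) ->
  bounded_mfun A f -> bounded_mfun B (fun x => f (k x)).
Proof.
move=> mA mk BA [mf [M fM]]; split; last by exists M => x /BA /fM.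
by apply: measurable_comp mf mk => // _ [x Bx <-]; exact: BA.
Qed.

End bounded_mfun_theory.

Section mean.
Context (d : measure_display) (T : measurableType d) (R : realType)
  (mu : {measure set T -> \bar R}) (A : set T) (mA : measurable A) (A1 : mu A = 1%E).
Implicit Types f g : T -> R.

Lemma bounded_mfun_integrable f : bounded_mfun A f -> mu.-integrable A (EFin \o f).
Proof.
by move=> [mf [M fM]]; apply: integrable_bounded fM => //; rewrite A1 ltry.
Qed.

Lemma mean_cst (c : R) : \int[mu]_(x in A) c = c.
Proof. by rewrite Rintegral_cst// A1 mulr1. Qed.

Lemma meanD f g : bounded_mfun A f -> bounded_mfun A g ->
  \int[mu]_(x in A) (f x + g x) = \int[mu]_(x in A) f x + \int[mu]_(x in A) g x.
Proof. by move=> bf bg; rewrite RintegralD//; exact: bounded_mfun_integrable. Qed.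

Lemma meanZ (c : R) f : bounded_mfun A f ->
  \int[mu]_(x in A) (c * f x) = c * \int[mu]_(x in A) f x.
Proof. by move=> bf; rewrite RintegralZl//; exact: bounded_mfun_integrable. Qed.

Lemma mean_le f g : bounded_mfun A f -> bounded_mfun A g ->
  (forall x, A x -> f x <= g x) -> \int[mu]_(x in A) f x <= \int[mu]_(x in A) g x.
Proof. by move=> bf bg fg; rewrite le_Rintegral//; exact: bounded_mfun_integrable. Qed.

Lemma normr_mean_le f (M : R) : measurable_fun A f -> (forall x, A x -> `|f x| <= M) ->
  `|\int[mu]_(x in A) f x| <= M.
Proof.
move=> mf fM; have bf : bounded_mfun A f by split=> //; exists M.
apply: le_trans (le_normr_Rintegral mA (bounded_mfun_integrable bf)) _.
rewrite -[leRHS]mean_cst; apply: mean_le => //; last exact: bounded_mfun_cst.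
split; first exact: measurableT_comp.
by exists M => y Ay; rewrite normr_id fM.
Qed.

Lemma mean_EFin f : bounded_mfun A f ->
  (\int[mu]_(x in A) (f x)%:E = (\int[mu]_(x in A) f x)%R%:E)%E.
Proof.
by move=> /bounded_mfun_integrable bf; rewrite /Rintegral fineK//; exact: integrable_fin_num bf.
Qed.

End mean.

(** * Averages over the unit square and the unit cube *)

Section unit_cube.
Context (R : realType).
Local Notation leb := (@lebesgue_measure R).
Local Notation I := (@I01 R).
Local Notation I2 := (I `*` I).
Local Notation I3 := (I2 `*` I).
Local Notation leb2 := (leb \x leb)%E.
Local Notation leb3 := ((leb \x leb) \x leb)%E.
Local Notation E2 f := (\int[leb2]_(p in I2) f p).
Local Notation E3 f := (\int[leb3]_(p in I3) f p).

Lemma measurable_I01 : measurable I.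
Proof. exact: measurable_itv. Qed.

Lemma leb_I01 : leb I = 1%E.
Proof. by rewrite /I01 lebesgue_measure_itv/= lte_fin ltr01 oppr0 adde0. Qed.

Let mI := measurable_I01.

Lemma measurable_square : measurable I2.
Proof. exact: measurableX. Qed.

Lemma leb_square : leb2 I2 = 1%E.
Proof. by rewrite [LHS]product_measure1E//= leb_I01 mule1. Qed.

Let mI2 := measurable_square.

Lemma measurable_cube : measurable I3.
Proof. exact: measurableX. Qed.

Lemma leb_cube : leb3 I3 = 1%E.
Proof. by rewrite [LHS]product_measure1E//= leb_square leb_I01 mule1. Qed.

Let Ioo : (leb I < +oo)%E. Proof. by rewrite leb_I01 ltry. Qed.
Let I2oo : (leb2 I2 < +oo)%E. Proof. by rewrite leb_square ltry. Qed.



Let mean_cst1 (c : R) : \int[leb]_(x in I) c = c.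
Proof. exact: (mean_cst (mu := leb) mI leb_I01). Qed.

Lemma bounded_mfun_xy (f : R * R -> R) : bounded_mfun I2 f ->
  bounded_mfun I3 (fun p => f p.1).
Proof.
apply: bounded_mfun_comp => //; last by move=> p [].
exact: measurable_funTS.
Qed.

Lemma bounded_mfun_xz (f : R * R -> R) : bounded_mfun I2 f ->
  bounded_mfun I3 (fun p => f (p.1.1, p.2)).
Proof.
apply: (bounded_mfun_comp (k := fun p : R * R * R => (p.1.1, p.2))) => //.
  apply: measurable_funTS; apply: measurable_fun_pair => //.
  exact: (measurableT_comp measurable_fst).
by move=> p [[]].
Qed.

Lemma bounded_mfun_yz (f : R * R -> R) : bounded_mfun I2 f ->
  bounded_mfun I3 (fun p => f (p.1.2, p.2)).
Proof.
apply: (bounded_mfun_comp (k := fun p : R * R * R => (p.1.2, p.2))) => //.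
  apply: measurable_funTS; apply: measurable_fun_pair => //.
  exact: (measurableT_comp measurable_snd).
by move=> p [[]].
Qed.

Lemma mean_square12 (f : R * R -> R) : bounded_mfun I2 f ->
  E2 f = \int[leb]_(x in I) \int[leb]_(y in I) f (x, y).
Proof.
move=> [mf [M fM]].
exact: (Rintegral_prod12 (m1 := leb) (m2 := leb) mI mI Ioo Ioo mf fM).
Qed.

Lemma mean_square21 (f : R * R -> R) : bounded_mfun I2 f ->
  E2 f = \int[leb]_(y in I) \int[leb]_(x in I) f (x, y).
Proof.
move=> [mf [M fM]].
exact: (Rintegral_prod21 (m1 := leb) (m2 := leb) mI mI Ioo Ioo mf fM).
Qed.

Lemma mean_cube12 (f : R * R * R -> R) : bounded_mfun I3 f ->
  E3 f = \int[leb2]_(p in I2) \int[leb]_(z in I) f (p, z).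
Proof.
move=> [mf [M fM]].
exact: (Rintegral_prod12 (m1 := sigma_finite_prod leb leb) (m2 := leb) mI2 mI I2oo Ioo mf fM).
Qed.

Lemma mean_cube21 (f : R * R * R -> R) : bounded_mfun I3 f ->
  E3 f = \int[leb]_(z in I) \int[leb2]_(p in I2) f (p, z).
Proof.
move=> [mf [M fM]].
exact: (Rintegral_prod21 (m1 := sigma_finite_prod leb leb) (m2 := leb) mI2 mI I2oo Ioo mf fM).
Qed.

Lemma bounded_mfun_section1 (f : R * R -> R) (x : R) : I x -> bounded_mfun I2 f ->
  bounded_mfun I (fun y => f (x, y)).
Proof.
move=> Ix [mf [M fM]]; split; first exact: measurable_section1 mf _ Ix.
by exists M => y Iy; exact: fM.
Qed.

Lemma bounded_mfun_section2 (f : R * R -> R) (y : R) : I y -> bounded_mfun I2 f ->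
  bounded_mfun I (fun x => f (x, y)).
Proof.
move=> Iy [mf [M fM]]; split; first exact: measurable_section2 mf _ Iy.
by exists M => x Ix; exact: fM.
Qed.

Lemma mean_xy (f : R * R -> R) : bounded_mfun I2 f -> E3 (fun p => f p.1) = E2 f.
Proof.
move=> bf; rewrite (mean_cube12 (bounded_mfun_xy bf)).
by apply: eq_Rintegral => p _ /=; exact: (mean_cst1 (f p)).
Qed.

Lemma mean_xz (f : R * R -> R) : bounded_mfun I2 f ->
  E3 (fun p => f (p.1.1, p.2)) = E2 f.
Proof.
move=> bf; rewrite (mean_cube21 (bounded_mfun_xz bf)) mean_square21//.
apply: eq_Rintegral => z; rewrite inE => Iz /=.
rewrite (mean_square12 (f := fun p => f (p.1, z))).
  by apply: eq_Rintegral => x _ /=; exact: (mean_cst1 (f (x, z))).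
apply: (bounded_mfun_comp (k := fst) mI _ _ (bounded_mfun_section2 Iz bf)).
  exact: measurable_funTS.
by move=> p [].
Qed.

Lemma mean_yz (f : R * R -> R) : bounded_mfun I2 f ->
  E3 (fun p => f (p.1.2, p.2)) = E2 f.
Proof.
move=> bf; rewrite (mean_cube21 (bounded_mfun_yz bf)) mean_square21//.
apply: eq_Rintegral => z; rewrite inE => Iz /=.
rewrite (mean_square21 (f := fun p => f (p.2, z))).
  by apply: eq_Rintegral => y _ /=; exact: (mean_cst1 (f (y, z))).
apply: (bounded_mfun_comp (k := snd) mI _ _ (bounded_mfun_section2 Iz bf)).
  exact: measurable_funTS.
by move=> p [].
Qed.

Lemma mean_mul_sections (f g : R -> R) : bounded_mfun I f -> bounded_mfun I g ->
  E2 (fun p => f p.1 * g p.2) = \int[leb]_(x in I) f x * \int[leb]_(y in I) g y.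
Proof.
move=> bf bg; rewrite mean_square12/=.
  under eq_Rintegral do rewrite (meanZ (mu := leb) mI leb_I01)//.
  by rewrite RintegralZr//; exact: (bounded_mfun_integrable (mu := leb) mI leb_I01).
apply: bounded_mfunM.
  apply: (bounded_mfun_comp (k := fst) mI _ _ bf); last by move=> p [].
  exact: measurable_funTS.
apply: (bounded_mfun_comp (k := snd) mI _ _ bg); last by move=> p [].
exact: measurable_funTS.
Qed.

(** With z integrated last, the inner integral is the square of the degree of z. *)
Lemma cherry_z_ge0 (u : R * R -> R) : bounded_mfun I2 u ->
  0 <= E3 (fun p => u (p.1.1, p.2) * u (p.1.2, p.2)).
Proof.
move=> bu; rewrite mean_cube21; last first.
  by apply: bounded_mfunM; [exact: bounded_mfun_xz|exact: bounded_mfun_yz].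
apply: Rintegral_ge0 => z Iz /=.
have bz := bounded_mfun_section2 Iz bu.
by rewrite (mean_mul_sections bz bz) -expr2 sqr_ge0.
Qed.

Lemma bounded_mfun_degree (u : R * R -> R) : bounded_mfun I2 u ->
  bounded_mfun I (fun x => \int[leb]_(y in I) u (x, y)).
Proof.
move=> bu; have [mu [M uM]] := bu; split.
  exact: (measurable_Rintegral_section (m1 := leb) (m2 := leb) mI mI Ioo Ioo mu uM).
exists M => x Ix; have [mux _] := bounded_mfun_section1 Ix bu.
by apply: (normr_mean_le (mu := leb) mI leb_I01 mux) => y Iy; exact: uM.
Qed.

(** Integrating z first leaves u(x, y) D(x) with D the degree, then D(x) ^ 2. *)
Lemma cherry_x_ge0 (u : R * R -> R) : bounded_mfun I2 u ->
  0 <= E3 (fun p => u p.1 * u (p.1.1, p.2)).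
Proof.
move=> bu; have bd := bounded_mfun_degree bu.
rewrite mean_cube12; last first.
  by apply: bounded_mfunM; [exact: bounded_mfun_xy|exact: bounded_mfun_xz].
pose D x := \int[leb]_(y in I) u (x, y).
have -> : \int[leb2]_(p in I2) \int[leb]_(z in I) (u (p, z).1 * u ((p, z).1.1, (p, z).2)) =
    E2 (fun p => u p * D p.1).
  apply: eq_Rintegral => p; rewrite inE => -[Ip _] /=.
  by rewrite (meanZ (mu := leb) mI leb_I01)//; exact: bounded_mfun_section1.
rewrite mean_square12/=; last first.
  apply: bounded_mfunM => //.
  apply: (bounded_mfun_comp (k := fst) mI _ _ bd); last by move=> p [].
  exact: measurable_funTS.
apply: Rintegral_ge0 => x Ix.
rewrite RintegralZr//; first by rewrite -expr2 sqr_ge0.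
exact/(bounded_mfun_integrable (mu := leb) mI leb_I01)/bounded_mfun_section1.
Qed.

(** Here the degree of y appears once through rows and once through columns, which
    is why symmetry is required. *)
Lemma cherry_y_ge0 (u : R * R -> R) : bounded_mfun I2 u ->
  (forall x y, I x -> I y -> u (x, y) = u (y, x)) ->
  0 <= E3 (fun p => u p.1 * u (p.1.2, p.2)).
Proof.
move=> bu usym; have bd := bounded_mfun_degree bu.
rewrite mean_cube12; last first.
  by apply: bounded_mfunM; [exact: bounded_mfun_xy|exact: bounded_mfun_yz].
pose D x := \int[leb]_(y in I) u (x, y).
have -> : \int[leb2]_(p in I2) \int[leb]_(z in I) (u (p, z).1 * u ((p, z).1.2, (p, z).2)) =
    E2 (fun p => u p * D p.2).
  apply: eq_Rintegral => p; rewrite inE => -[_ Ip] /=.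
  by rewrite (meanZ (mu := leb) mI leb_I01)//; exact: bounded_mfun_section1.
rewrite mean_square21/=; last first.
  apply: bounded_mfunM => //.
  apply: (bounded_mfun_comp (k := snd) mI _ _ bd); last by move=> p [].
  exact: measurable_funTS.
apply: Rintegral_ge0 => y Iy.
rewrite RintegralZr//; last exact/(bounded_mfun_integrable (mu := leb) mI leb_I01)/bounded_mfun_section2.
rewrite (_ : \int[leb]_(x in I) u (x, y) = D y); first by rewrite -expr2 sqr_ge0.
by apply: eq_Rintegral => x; rewrite inE => Ix; exact: usym.
Qed.

(** * Graphons close to a constant *)

Lemma bounded_mfun_graphon (W : R * R -> R) : graphon W -> bounded_mfun I2 W.
Proof.
move=> [mW _ W01]; split=> //; exists 1 => -[x y] [Ix Iy].
by have /andP[W0 W1] := W01 _ _ Ix Iy; rewrite ger0_norm.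
Qed.

Lemma triangle_densityE (W : R * R -> R) : graphon W -> triangle_density W =
  (E3 (fun p => W p.1 * W (p.1.1, p.2) * W (p.1.2, p.2)))%:E.
Proof.
move=> /bounded_mfun_graphon bW.
rewrite -(mean_EFin (mu := leb3) measurable_cube leb_cube).
  by apply: eq_integral => -[[x y] z] _.
apply: bounded_mfunM; last exact: bounded_mfun_yz.
by apply: bounded_mfunM; [exact: bounded_mfun_xy|exact: bounded_mfun_xz].
Qed.

Lemma bounded_mfun_h (W : R * R -> R) : graphon W -> bounded_mfun I2 (fun p => h (W p)).
Proof.
move=> gW; have [mW _ W01] := gW; split.
  apply: (measurableT_comp (f := @h R)) => //.
  apply: measurable_funD => //; apply: measurable_funB => //.
  by apply: measurable_funM => //; exact: measurable_ln.
exists 1 => -[x y] [Ix Iy]; have /andP[W0 W1] := W01 _ _ Ix Iy.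
rewrite ger0_norm ?h_ge0// /h.
have := mulr_ge0_le0 W0 (ln_le0 W1); move: (_ * ln _) W0 => w W0; clear -W0 w; lra.
Qed.

Lemma graphon_expectation_hE (W : R * R -> R) : graphon W ->
  graphon_expectation h W = (E2 (fun p => h (W p)))%:E.
Proof.
move=> gW; rewrite -(mean_EFin (mu := leb2) measurable_square leb_square)//.
exact: bounded_mfun_h.
Qed.

Lemma graphon_cst (r : R) : 0 <= r <= 1 -> graphon (fun _ : R * R => r).
Proof. by move=> r01; split=> //; exact: measurable_cst. Qed.

Lemma triangle_density_cst (r : R) : 0 <= r <= 1 ->
  triangle_density (fun _ : R * R => r) = (r ^+ 3)%:E.
Proof.
move=> r01; rewrite triangle_densityE; last exact: graphon_cst.
by rewrite (mean_cst (mu := leb3) measurable_cube leb_cube) !exprS expr0 mulr1 mulrA.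
Qed.

Lemma graphon_expectation_h_cst (r : R) : 0 <= r <= 1 ->
  graphon_expectation h (fun _ : R * R => r) = (h r)%:E.
Proof.
move=> r01; rewrite graphon_expectation_hE; last exact: graphon_cst.
by rewrite (mean_cst (mu := leb2) measurable_square leb_square).
Qed.

(** From |a| <= K, the quadratic form K (b ^ 2 + c ^ 2) / 2 + a b c is nonnegative;
    the bound is the average of the three such inequalities. *)
Lemma mul3_ge (K a b c : R) : `|a| <= K -> `|b| <= K -> `|c| <= K ->
  - (K / 3) * (a ^+ 2 + b ^+ 2 + c ^+ 2) <= a * b * c.
Proof.
have le1 (x y z : R) : `|x| <= K -> - (K / 2) * (y ^+ 2 + z ^+ 2) <= x * y * z.
  rewrite ler_norml => /andP[Kx xK].
  have : 0 <= (K + x) * (y + z) ^+ 2 by rewrite mulr_ge0 ?sqr_ge0//; lra.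
  have : 0 <= (K - x) * (y - z) ^+ 2 by rewrite mulr_ge0 ?sqr_ge0//; lra.
  lra.
by move=> /(le1 _ b c) A /(le1 _ a c) B /(le1 _ a b) C; lra.
Qed.

(** The expansion of (r + u) (r + u) (r + u): the product of three u is bounded
    below pointwise, while the cherries have nonnegative mean. *)
Lemma triangle_mean_ge (W : R * R -> R) (r K : R) : graphon W -> 0 <= r ->
  (forall p, I2 p -> `|W p - r| <= K) ->
  r ^+ 3 + 3 * r ^+ 2 * E2 (fun p => W p - r) - K * E2 (fun p => (W p - r) ^+ 2) <=
  E3 (fun p => W p.1 * W (p.1.1, p.2) * W (p.1.2, p.2)).
Proof.
move=> gW r0 WK; have bW := bounded_mfun_graphon gW.
pose u p := W p - r.
have bu : bounded_mfun I2 u by apply: bounded_mfunD => //; exact: bounded_mfun_cst.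
have bu2 : bounded_mfun I2 (fun p => u p ^+ 2) by exact: bounded_mfunM.
have usym x y : I x -> I y -> u (x, y) = u (y, x).
  by move=> Ix Iy; rewrite /u; case: gW => _ -> .
(* the part of the lower bound that depends on a single edge *)
pose phi p := r ^+ 2 * u p + (- (K / 3)) * u p ^+ 2.
have bphi : bounded_mfun I2 phi.
  apply: bounded_mfunD; (apply: bounded_mfunM => //; exact: bounded_mfun_cst).
have Ephi : E2 phi = r ^+ 2 * E2 u - K / 3 * E2 (fun p => u p ^+ 2).
  rewrite (meanD (mu := leb2) mI2 leb_square).
  - by rewrite !(meanZ (mu := leb2) mI2 leb_square)// mulNr.
  - by apply: bounded_mfunM => //; exact: bounded_mfun_cst.
  - by apply: bounded_mfunM => //; exact: bounded_mfun_cst.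
have [bxy bxz byz] := And3 (bounded_mfun_xy bu) (bounded_mfun_xz bu) (bounded_mfun_yz bu).
have [pxy pxz pyz] := And3 (bounded_mfun_xy bphi) (bounded_mfun_xz bphi) (bounded_mfun_yz bphi).
have [cx cy cz] := And3 (bounded_mfunM bxy bxz) (bounded_mfunM bxy byz) (bounded_mfunM bxz byz).
pose lin (p : R * R * R) := phi p.1 + phi (p.1.1, p.2) + phi (p.1.2, p.2).
pose che (p : R * R * R) :=
  u p.1 * u (p.1.1, p.2) + u p.1 * u (p.1.2, p.2) + u (p.1.1, p.2) * u (p.1.2, p.2).
have blin : bounded_mfun I3 lin by apply: bounded_mfunD => //; exact: bounded_mfunD.
have bche : bounded_mfun I3 che by apply: bounded_mfunD => //; exact: bounded_mfunD.
have Elin : E3 lin = 3 * E2 phi.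
  rewrite (meanD (mu := leb3) measurable_cube leb_cube)//; last exact: bounded_mfunD.
  rewrite (meanD (mu := leb3) measurable_cube leb_cube)//.
  by rewrite mean_xy// mean_xz// mean_yz// mulr_natl mulrSr mulr2n.
have Eche : 0 <= E3 che.
  rewrite (meanD (mu := leb3) measurable_cube leb_cube)//; last exact: bounded_mfunD.
  rewrite (meanD (mu := leb3) measurable_cube leb_cube)//.
  by rewrite !addr_ge0 ?cherry_x_ge0 ?cherry_y_ge0 ?cherry_z_ge0.
have bF : bounded_mfun I3 (fun p => r ^+ 3 + (lin p + r * che p)).
  apply: bounded_mfunD; first exact: bounded_mfun_cst.
  by apply: bounded_mfunD => //; apply: bounded_mfunM => //; exact: bounded_mfun_cst.
have EF : E3 (fun p => r ^+ 3 + (lin p + r * che p)) = r ^+ 3 + (3 * E2 phi + r * E3 che).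
  have brc : bounded_mfun I3 (fun p => r * che p).
    by apply: bounded_mfunM => //; exact: bounded_mfun_cst.
  rewrite (meanD (mu := leb3) measurable_cube leb_cube); last exact: bounded_mfunD.
    rewrite (mean_cst (mu := leb3) measurable_cube leb_cube).
    rewrite (meanD (mu := leb3) measurable_cube leb_cube)// Elin.
    by rewrite (meanZ (mu := leb3) measurable_cube leb_cube).
  exact: bounded_mfun_cst.
apply: (@le_trans _ _ (E3 (fun p => r ^+ 3 + (lin p + r * che p)))).
  rewrite EF Ephi; have := mulr_ge0 r0 Eche.
  move: (r * _) (E2 u) (E2 (fun p => u p ^+ 2)) => a d q; clear; lra.
apply: (mean_le (mu := leb3) measurable_cube leb_cube) => //.
  apply: bounded_mfunM; last exact: bounded_mfun_yz.
  by apply: bounded_mfunM; [exact: bounded_mfun_xy|exact: bounded_mfun_xz].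
move=> [[x y] z] [[Ix Iy] Iz]; rewrite /lin /che /phi /=.
have WE p : W p = r + u p by rewrite /u addrC subrK.
have Kxy : `|u (x, y)| <= K by apply: WK.
have Kxz : `|u (x, z)| <= K by apply: WK.
have Kyz : `|u (y, z)| <= K by apply: WK.
rewrite !WE; have := mul3_ge Kxy Kxz Kyz.
move: (u (x, y)) (u (x, z)) (u (y, z)) => a b c; clear; lra.
Qed.

Lemma entropy_mean_ge (W : R * R -> R) (r : R) : graphon W -> 0 < r ->
  h r + ln r * E2 (fun p => W p - r) +
    3 / (4 * r + 2) * E2 (fun p => (W p - r) ^+ 2) <= E2 (fun p => h (W p)).
Proof.
move=> gW r0; have bW := bounded_mfun_graphon gW.
have bu : bounded_mfun I2 (fun p => W p - r).
  by apply: bounded_mfunD => //; exact: bounded_mfun_cst.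
have bu2 : bounded_mfun I2 (fun p => (W p - r) ^+ 2) by exact: bounded_mfunM.
have blu : bounded_mfun I2 (fun p => ln r * (W p - r)).
  by apply: bounded_mfunM => //; exact: bounded_mfun_cst.
have bcu : bounded_mfun I2 (fun p => 3 / (4 * r + 2) * (W p - r) ^+ 2).
  by apply: bounded_mfunM => //; exact: bounded_mfun_cst.
have bhl : bounded_mfun I2 (fun p => h r + ln r * (W p - r)).
  by apply: bounded_mfunD => //; exact: bounded_mfun_cst.
rewrite -(meanZ (mu := leb2) mI2 leb_square)// -(meanZ (mu := leb2) mI2 leb_square)//.
rewrite -[h r in leLHS](mean_cst (mu := leb2) mI2 leb_square).
rewrite -(meanD (mu := leb2) mI2 leb_square)//; last exact: bounded_mfun_cst.
rewrite -(meanD (mu := leb2) mI2 leb_square)//.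
apply: (mean_le (mu := leb2) mI2 leb_square).
- exact: bounded_mfunD.
- exact: bounded_mfun_h.
- move=> [x y] [Ix Iy]; apply: h_ge_quadratic => //.
  by case: gW => _ _; apply.
Qed.

Lemma square_mean_eq0 (W : R * R -> R) (r : R) : graphon W ->
  E2 (fun p => (W p - r) ^+ 2) = 0 -> graphon_ae_eq W (fun=> r).
Proof.
move=> gW q0; have bW := bounded_mfun_graphon gW.
have bu : bounded_mfun I2 (fun p => W p - r).
  by apply: bounded_mfunD => //; exact: bounded_mfun_cst.
have bu2 : bounded_mfun I2 (fun p => (W p - r) ^+ 2) by exact: bounded_mfunM.
have [mu2 _] := bu2.
have : ae_eq leb2 I2 (fun p => ((W p - r) ^+ 2)%:E) (cst 0%E).
  apply/(ae_eq_integral_abs leb2 mI2); first exact/measurable_EFinP.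
  transitivity (\int[leb2]_(p in I2) ((W p - r) ^+ 2)%:E)%E.
    by apply: eq_integral => p _; rewrite gee0_abs// lee_fin sqr_ge0.
  by rewrite (mean_EFin (mu := leb2) mI2 leb_square)// q0.
apply: filterS => p /[apply] -[] /eqP.
by rewrite sqrf_eq0 subr_eq0 => /eqP.
Qed.

Lemma mean_entropy_gap (W : R * R -> R) (r : R) : 466 / 10 ^+ 3 <= r <= 1 -> graphon W ->
  E3 (fun p => W p.1 * W (p.1.1, p.2) * W (p.1.2, p.2)) <= r ^+ 3 ->
  h r <= E2 (fun p => h (W p)) /\
  (E2 (fun p => h (W p)) <= h r -> E2 (fun p => (W p - r) ^+ 2) = 0).
Proof.
move=> r46 gW tW; have /andP[r466 r1] := r46.
have r0 : 0 < r by apply: lt_le_trans r466; lra.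
pose K := Num.max r (1 - r).
have K1 : r <= K by rewrite le_max lexx.
have K2 : 1 - r <= K by rewrite le_max lexx orbT.
have WK p : I2 p -> `|W p - r| <= K.
  case: p => x y [Ix Iy]; case: gW => _ _ /(_ _ _ Ix Iy) /= /andP[W0 W1].
  move: (W (x, y)) W0 W1 => w W0 W1; rewrite ler_norml; apply/andP; split; lra.
have T := le_trans (triangle_mean_ge gW (ltW r0) WK) tW.
have E := entropy_mean_ge gW r0.
have q0 : 0 <= E2 (fun p => (W p - r) ^+ 2) by apply: Rintegral_ge0 => p _; exact: sqr_ge0.
move: (E2 (fun p => h (W p))) (E2 (fun p => W p - r)) (E2 (fun p => (W p - r) ^+ 2)) T E q0.
move=> H d q T E q0.
have {}T : 3 * r ^+ 2 * d <= K * q by lra.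
have [[q00 ld]|gt0] := slope_dominated r46 q0 T; last by split; lra.
by move: E; rewrite q00 mulr0 addr0 => E; split=> //; lra.
Qed.

Lemma constant_uniquely_minimizes (r : R) : 466 / 10 ^+ 3 <= r <= 1 ->
  uniquely_minimizes_LT_K3 r (fun _ : R * R => r).
Proof.
move=> r46; have r01 : 0 <= r <= 1.
  by have /andP[r466 ->] := r46; rewrite andbT; apply: le_trans r466; lra.
have feas : LT_K3_feasible r (fun _ : R * R => r).
  by split; [exact: graphon_cst|rewrite triangle_density_cst].
have gap W : LT_K3_feasible r W -> h r <= E2 (fun p => h (W p)) /\
    (E2 (fun p => h (W p)) <= h r -> E2 (fun p => (W p - r) ^+ 2) = 0).
  move=> [gW tW]; apply: mean_entropy_gap => //.
  by move: tW; rewrite triangle_densityE// lee_fin.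
split=> [|W [fW /(_ _ feas)]].
  split=> // W fW; rewrite graphon_expectation_h_cst// graphon_expectation_hE; last by case: fW.
  by rewrite lee_fin; case: (gap _ fW).
have gW : graphon W by case: fW.
rewrite graphon_expectation_h_cst// graphon_expectation_hE// lee_fin => hW.
apply: rst_step; split; [exact: gW|exact: graphon_cst|left].
by apply: square_mean_eq0 => //; case: (gap _ fW) => _; apply.
Qed.

(** * Block graphons *)

Definition half_sign (x : R) : R := 2 * \1_(`[0, 1 / 2[%classic : set R) x - 1.

Lemma half_sign_cases (x : R) : half_sign x = 1 \/ half_sign x = -1.
Proof. by rewrite /half_sign indicE; case: (_ \in _) => /=; [left|right]; lra. Qed.

Lemma measurable_half_sign : measurable_fun I half_sign.
Proof.
by apply: measurable_funB => //; exact: measurable_funM.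
Qed.

Lemma bounded_mfun_half_sign : bounded_mfun I half_sign.
Proof.
split; first exact: measurable_half_sign.
by exists 1 => x _; case: (half_sign_cases x) => ->; rewrite ?normrN normr1.
Qed.

Lemma mean_half_sign : \int[leb]_(x in I) half_sign x = 0.
Proof.
have bi : bounded_mfun I (\1_(`[0, 1 / 2[%classic : set R) : R -> R).
  split; first by apply: measurable_funTS; exact: measurable_indic.
  by exists 1 => x _; rewrite indicE; case: (_ \in _); rewrite ?normr1 ?normr0.
have b2i : bounded_mfun I (fun x => 2 * (\1_(`[0, 1 / 2[%classic : set R) x : R)).
  by apply: bounded_mfunM => //; exact: bounded_mfun_cst.
rewrite (meanD (mu := leb) mI leb_I01)//; last exact: bounded_mfun_cst.
rewrite (meanZ (mu := leb) mI leb_I01)// (mean_cst (mu := leb) mI leb_I01).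
suff -> : \int[leb]_(x in I) (\1_(`[0, 1 / 2[%classic : set R) x : R) = 1 / 2 by lra.
rewrite /Rintegral integral_indic//.
rewrite (_ : _ `&` I = `[0, 1 / 2[%classic).
  have half : leb `[0, 1 / 2[%classic = (1 / 2)%:E.
    rewrite lebesgue_measure_itv/= lte_fin.
    have -> : 0 < 1 / 2 :> R by lra.
    by rewrite oppr0 adde0.
  exact: (congr1 fine half).
apply/seteqP; split=> x; rewrite /I01 /= !in_itv/=; first by case.
by move=> /andP[x0 x1]; split; [rewrite x0|rewrite x0/=; lra].
Qed.

(** Value a on the diagonal blocks and b off them, in the spectral form that makes
    products easy to average: half_sign has mean 0 and square 1. *)
Definition block_graphon (a b : R) (p : R * R) : R :=
  (a + b) / 2 + (a - b) / 2 * (half_sign p.1 * half_sign p.2).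

Lemma block_graphon_cases (a b : R) (p : R * R) :
  half_sign p.1 * half_sign p.2 = 1 /\ block_graphon a b p = a \/
  half_sign p.1 * half_sign p.2 = -1 /\ block_graphon a b p = b.
Proof.
rewrite /block_graphon.
by case: (half_sign_cases p.1) (half_sign_cases p.2) => -> [] ->;
  [left|right|right|left]; split; lra.
Qed.

Let sign2 (p : R * R) := half_sign p.1 * half_sign p.2.

Let bounded_sign2 : bounded_mfun I2 sign2.
Proof.
have bs := bounded_mfun_half_sign; apply: bounded_mfunM.
  apply: (bounded_mfun_comp (k := fst) mI _ _ bs); last by move=> p [].
  exact: measurable_funTS.
apply: (bounded_mfun_comp (k := snd) mI _ _ bs); last by move=> p [].
exact: measurable_funTS.
Qed.

Let mean_sign2 : E2 sign2 = 0.
Proof.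
have bs := bounded_mfun_half_sign.
by rewrite (mean_mul_sections bs bs) mean_half_sign mul0r.
Qed.

Lemma graphon_block (a b : R) : 0 <= a <= 1 -> 0 <= b <= 1 -> graphon (block_graphon a b).
Proof.
move=> a01 b01; split=> [|x y _ _|x y _ _].
- have [] : bounded_mfun I2 (block_graphon a b) by
    apply: bounded_mfunD; [exact: bounded_mfun_cst|
      apply: bounded_mfunM => //; exact: bounded_mfun_cst].
  by [].
- by rewrite /block_graphon /= [half_sign x * _]mulrC.
- by case: (block_graphon_cases a b (x, y)) => -[_ ->].
Qed.

Lemma triangle_density_block (a b : R) : 0 <= a <= 1 -> 0 <= b <= 1 ->
  triangle_density (block_graphon a b) = ((a ^+ 3 + 3 * a * b ^+ 2) / 4)%:E.
Proof.
move=> a01 b01; rewrite triangle_densityE; last exact: graphon_block.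
congr EFin.
pose s := (a + b) / 2; pose t := (a - b) / 2.
pose lin (p : R * R * R) := sign2 p.1 + sign2 (p.1.1, p.2) + sign2 (p.1.2, p.2).
have [pxy pxz pyz] := And3 (bounded_mfun_xy bounded_sign2) (bounded_mfun_xz bounded_sign2)
  (bounded_mfun_yz bounded_sign2).
have blin : bounded_mfun I3 lin by apply: bounded_mfunD => //; exact: bounded_mfunD.
have Elin : E3 lin = 0.
  rewrite (meanD (mu := leb3) measurable_cube leb_cube)//; last exact: bounded_mfunD.
  rewrite (meanD (mu := leb3) measurable_cube leb_cube)//.
  by rewrite (mean_xy bounded_sign2) (mean_xz bounded_sign2) (mean_yz bounded_sign2)
    mean_sign2 !addr0.
(* the product of the signs of two edges is the sign of the third, so all the
   powers collapse to constants and single signs, which average to 0 *)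
transitivity (E3 (fun p => s ^+ 3 + t ^+ 3 + (s ^+ 2 * t + s * t ^+ 2) * lin p)).
  apply: eq_Rintegral => -[[x y] z] _; rewrite /block_graphon /lin /sign2 /= -/s -/t.
  case: (half_sign_cases x) (half_sign_cases y) (half_sign_cases z) => -> [] -> [] ->;
    by move: s t => s t; ring.
rewrite (meanD (mu := leb3) measurable_cube leb_cube).
- rewrite (mean_cst (mu := leb3) measurable_cube leb_cube).
  rewrite (meanZ (mu := leb3) measurable_cube leb_cube)// Elin mulr0 addr0 /s /t.
  by field.
- exact: bounded_mfun_cst.
- by apply: bounded_mfunM => //; exact: bounded_mfun_cst.
Qed.

Lemma graphon_expectation_h_block (a b : R) : 0 <= a <= 1 -> 0 <= b <= 1 ->
  graphon_expectation h (block_graphon a b) = ((h a + h b) / 2)%:E.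
Proof.
move=> a01 b01; rewrite graphon_expectation_hE; last exact: graphon_block.
congr EFin.
transitivity (E2 (fun p => (h a + h b) / 2 + (h a - h b) / 2 * sign2 p)).
  apply: eq_Rintegral => p _; rewrite /sign2.
  by case: (block_graphon_cases a b p) => -[-> ->]; move: (h a) (h b) => c d; field.
rewrite (meanD (mu := leb2) mI2 leb_square).
- rewrite (mean_cst (mu := leb2) mI2 leb_square) (meanZ (mu := leb2) mI2 leb_square)//.
  by rewrite mean_sign2 mulr0 addr0.
- exact: bounded_mfun_cst.
- by apply: bounded_mfunM => //; exact: bounded_mfun_cst.
Qed.

Lemma block_beats_constant (r a b : R) : 0 <= r <= 1 -> 0 <= a <= 1 -> 0 <= b <= 1 ->
  (a ^+ 3 + 3 * a * b ^+ 2) / 4 <= r ^+ 3 -> (h a + h b) / 2 < h r ->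
  ~ minimizes_LT_K3 r (fun _ : R * R => r).
Proof.
move=> r01 a01 b01 tab hab [_ /(_ (block_graphon a b))].
rewrite graphon_expectation_h_cst// graphon_expectation_h_block// lee_fin leNgt hab => H.
have // : false; apply: H; split; first exact: graphon_block.
by rewrite triangle_density_block// lee_fin.
Qed.

End unit_cube.

(** The block graphon that ties at rho, shrunk to scale r; at r = 0 the complete
    bipartite graphon, which is triangle free and costs 1 / 2 < 1. *)
Lemma constant_not_minimizer (R : realType) (r rho : R) : is_runder rho -> 0 <= r < rho ->
  ~ minimizes_LT_K3 r (fun _ : R * R => r).
Proof.
move=> [[/andP[rho0 rho1] /(f_has_zeroP rho0)[u [uI v1 g0]]] _] /andP[r0 rrho].
have r01 : 0 <= r <= 1 by rewrite r0/=; lra.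
move: r0; rewrite le_eqVlt => /orP[/eqP r0|r0].
  have ln0 : ln (0 : R) = 0 by rewrite ln0.
  apply: (@block_beats_constant _ r 0 1) => //; rewrite ?lexx ?ler01//.
    by rewrite -r0 !expr0n/= mulr0 mul0r addr0 mul0r.
  by rewrite h_1 -r0 /h mul0r; lra.
have /andP[u0 u1] := uI; have w1 := partner_gt1 uI.
have rv : r * partner u <= 1.
  by apply: le_trans v1; rewrite ler_pM2r ?ltW//; lra.
have ru : r * u <= 1 by rewrite mulr_ile1//; lra.
apply: (@block_beats_constant _ r (r * u) (r * partner u)) => //.
- by rewrite ru andbT mulr_ge0//; lra.
- by rewrite rv andbT mulr_ge0//; lra.
- have -> : (r * u) ^+ 3 + 3 * (r * u) * (r * partner u) ^+ 2 =
    r ^+ 3 * (u ^+ 3 + 3 * u * partner u ^+ 2) by ring.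
  by rewrite partner_eq// mulfK// pnatr_eq0.
- have gneg : scaled_f (ln r) u < 0.
    rewrite -g0 /scaled_f ltrD2l ltr_pM2r ?subr_gt0 ?add_partner_gt2//.
    by rewrite ltr_ln ?posrE.
  have : r / 2 * scaled_f (ln r) u < 0 by rewrite pmulr_rlt0// divr_gt0.
  rewrite -f_r_scale// /f_r f_arg_scale//.
  by move: (h (r * u)) (h (r * partner u)) (h r) => A B C; clear; lra.
Qed.

Theorem theorem2p6 (R : realType) :
  exists rbar runder : R,
    [/\ unique is_rbar rbar /\ 466 / 1000 <= rbar < 467 / 1000,
        is_runder runder /\ 209 / 1000 <= runder < 210 / 1000,
        forall r : R, rbar < r <= 1 ->
          uniquely_minimizes_LT_K3 r (fun=> r)
      & forall r : R, 0 <= r < runder ->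
          ~ minimizes_LT_K3 r (fun=> r)].
Proof.
have thousand : 1000 = 10 ^+ 3 :> R by rewrite -natrX.
rewrite thousand.
have [rbar isr rbar_bounds] := is_rbar_exists R.
have [runder isru runder_bounds] := is_runder_exists R.
exists rbar, runder; split=> //.
- by split=> //; split=> // s iss; exact: is_rbar_unique.
- move=> r /andP[rbar_r r1]; apply: constant_uniquely_minimizes; rewrite r1 andbT.
  by have /andP[low _] := rbar_bounds; exact: le_trans low (ltW rbar_r).
- by move=> r; exact: constant_not_minimizer.
Qed.
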